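(* Let $(\Sigma,\sigma)$ be a finite entropy, transitive countable Markov shift and let $\mu$ be a $\sigma$-invariant probability measure on $\Sigma$. Then there exists a sequence $(\mu_n)_n$ of ergodic $\sigma$-invariant probability measures such that $(\mu_n)_n$ converges to $\mu$ in the weak$^*$ topology and $\lim_{n\to\infty}h_{\mu_n}(\sigma)=h_\mu(\sigma)$; that is, the set of ergodic measures is entropy dense. Moreover, it is possible to choose the sequence so that each $\mu_n$ has compact support.
   Context: $\mathbb{N}=\{1,2,\dots\}$, $\mathbb{N}_0=\mathbb{N}\cup\{0\}$. A (one-sided) countable Markov shift (CMS) $(\Sigma,\sigma)$ is given by a matrix $(A(i,j))_{i,j\in\mathbb{N}}$ with entries in $\{0,1\}$: $\Sigma=\{(x_0,x_1,\dots)\in\mathbb{N}^{\mathbb{N}_0}: A(x_i,x_{i+1})=1\ \forall i\in\mathbb{N}_0\}$ with the topology induced from the product topology ($\mathbb{N}$ discrete), and $\sigma$ is the left shift. A word $a_0\ldots a_{N-1}$ is admissible if $A(a_i,a_{i+1})=1$ for $0\le i\le N-2$. $(\Sigma,\sigma)$ is transitive if its directed graph is connected in the directed sense: for all $a,b\in\mathbb{N}$ some admissible word starts at $a$ and ends at $b$. ''Finite entropy'' means $h_{top}(\sigma)<\infty$, where for a transitive CMS $h_{top}(\sigma)=\limsup_{n\to\infty}\frac1n\log\#\{x\in\Sigma:\sigma^n x=x,\ x_0=a\}$, independent of $a$. $h_\mu(\sigma)$ is measure-theoretic entropy. Weak$^*$ convergence is tested against bounded continuous functions on $\Sigma$. A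 set $\mathcal{L}$ of invariant probability measures is entropy dense if every invariant probability measure $\mu$ is a weak$^*$ limit of a sequence $(\mu_n)_n$ in $\mathcal{L}$ with $h_{\mu_n}(\sigma)\to h_\mu(\sigma)$. *)

(* Defs.v *)
From HB Require Import structures.
From mathcomp Require Import all_boot all_order all_algebra.
From mathcomp Require Import all_classical all_reals all_analysis.

Set Implicit Arguments.
Unset Strict Implicit.
Unset Printing Implicit Defensive.

Import Order.TTheory GRing.Theory Num.Theory.
Import numFieldNormedType.Exports.

Local Open Scope classical_set_scope.
Local Open Scope ring_scope.

Section measure_preserving_systems.
Context d (T : measurableType d) (R : realType).
Implicit Types (f : T -> T) (mu : probability T R).

Definition invariant_measure f mu :=
  forall B, measurable B -> mu (f @^-1` B) = mu B.

Definition ergodic_measure f mu :=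
  invariant_measure f mu /\
  forall B, measurable B -> f @^-1` B = B -> mu B = 0%E \/ mu B = 1%E.

(* A finite partition of T into (possibly empty) pieces is given by the        *)
(* function P : T -> 'I_k sending a point to the index of its piece.           *)
Definition measurable_partition k (P : T -> 'I_k) :=
  forall i, measurable (P @^-1` [set i]).

(* The piece with index w of the join of the partitions P, P \o f, ...,        *)
(* P \o f^(n-1).                                                               *)
Definition join_piece f k (P : T -> 'I_k) n (w : {ffun 'I_n -> 'I_k}) : set T :=
  [set x | forall i : 'I_n, P (iter i f x) = w i].

(* 0 * ln 0 = 0 since ln 0 = 0 in the library.                                 *)
Definition join_entropy f mu k (P : T -> 'I_k) n : R :=
  - \sum_(w : {ffun 'I_n -> 'I_k})
      fine (mu (join_piece f P w)) * ln (fine (mu (join_piece f P w))).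

Definition partition_entropy f mu k (P : T -> 'I_k) : R :=
  limn (fun n => join_entropy f mu P n / n%:R).

Definition measure_entropy f mu : \bar R :=
  ereal_sup [set h | exists k (P : T -> 'I_k),
    measurable_partition P /\ h = (partition_entropy f mu P)%:E].

End measure_preserving_systems.

(* The alphabet is nat, 0 included, instead of {1, 2, ...}.                    *)
Definition transitive_matrix (A : rel nat) :=
  forall a b, exists2 w, path A a w & last a w = b.

Definition admissible_sequences (A : rel nat) : set {ptws nat -> nat} :=
  [set x | forall i, A (x i) (x i.+1)].

Lemma admissible_sequences_neq0 (A : rel nat) :
  transitive_matrix A -> admissible_sequences A !=set0.
Proof.
move=> trA.
have succA a : exists b, A a b.
  have [[|b w] /= p l] := trA a a.+1; last by exists b; case/andP: p.
  by case: (n_Sn a).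
have [s As] := choice succA.
by exists (fun i => iter i s 0%N) => i /=; exact: As.
Qed.

(* The space Sigma with the topology induced by the product topology. It does  *)
(* not depend on the transitivity of A, which only serves to provide the point *)
(* that the library requires of a measurable space.                            *)
Definition cms (A : rel nat) (trA : transitive_matrix A) : Type :=
  set_type (admissible_sequences A).

Section countable_markov_shift.
Context (A : rel nat) (trA : transitive_matrix A).

HB.instance Definition _ := Topological.copy (cms trA)
  (set_type (admissible_sequences A)).

Definition cms_point : cms trA :=
  SigSub (mem_set (projT2 (cid (admissible_sequences_neq0 trA)))).

HB.instance Definition _ := isPointed.Build (cms trA) cms_point.

HB.instance Definition _ := Measurable.copy (cms trA)
  (g_sigma_algebraType (@open (cms trA))).

Definition cms_coord (x : cms trA) (i : nat) : nat := set_val x i.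

Lemma shift_admissible (x : cms trA) :
  admissible_sequences A (fun i => cms_coord x i.+1).
Proof. by move=> i; exact: (set_valP x i.+1). Qed.

Definition cms_shift (x : cms trA) : cms trA := SigSub (mem_set (shift_admissible x)).

Variable R : realType.
Implicit Types mu : probability (cms trA) R.

Definition periodic_from (a n : nat) : set (cms trA) :=
  [set x | iter n cms_shift x = x /\ cms_coord x 0 = a].

Definition top_entropy (a : nat) : \bar R :=
  limn_esup (fun n => (n%:R^-1)%:E * lne (counting (periodic_from a n)))%E.

(* As A is transitive, top_entropy a does not depend on a.                     *)
Definition finite_entropy := exists a, (top_entropy a < +oo)%E.

Definition weak_star_cvg (mu_ : nat -> probability (cms trA) R) mu :=
  forall f : cms trA -> R, continuous f -> (exists M, forall x, `|f x| <= M) ->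
    (fun n => \int[mu_ n]_x (f x)%:E)%E @ \oo --> (\int[mu]_x (f x)%:E)%E.

Definition msupport mu : set (cms trA) :=
  [set x | forall U : set (cms trA), open U -> U x -> (0 < mu U)%E].

Definition entropy_dense (L : set (probability (cms trA) R)) :=
  forall mu, invariant_measure cms_shift mu ->
    exists mu_ : nat -> probability (cms trA) R,
      [/\ forall n, L (mu_ n), weak_star_cvg mu_ mu &
          measure_entropy cms_shift (mu_ n) @[n --> \oo] -->
            measure_entropy cms_shift mu].

End countable_markov_shift.

Arguments cms_shift {A trA} x.
Arguments finite_entropy {A} trA R.

(* Main.v *)
Require Import Defs.
From HB Require Import structures.
From mathcomp Require Import all_boot all_order all_algebra.
From mathcomp Require Import all_classical all_reals all_analysis.
From mathcomp Require Import measurable_realfun.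
From mathcomp Require Import zify ring lra.

Set Implicit Arguments.
Unset Strict Implicit.
Unset Printing Implicit Defensive.

Import Order.TTheory GRing.Theory Num.Theory.
Import numFieldNormedType.Exports.

Local Open Scope classical_set_scope.
Local Open Scope ring_scope.

(** The theorem is a construction.  Let mu be invariant and let c be h(mu) if
this is finite, a large number otherwise.  For every precision there is an
ergodic measure nu with compact support, with entropy close to c, that gives to
each short cylinder at least almost the mass that mu gives to it
([ergodic_approximation]).  As the cylinders of a fixed length partition the
space, lower bounds on their masses force weak* convergence
([weak_star_cvg_cyl]).

The measure nu lives on a horseshoe: all sequences obtained by concatenating
freely the loops of a finite set D of loops of one length T, based at one letter
([horseshoe]).  The loops come from mu in three steps.

Words.  The entropy of mu is already seen by the finite partitions [alpha M] of
the space according to the first letter, truncated at M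
([join_entropy_le_alpha]).  So the words of length N, weighted by the mass of
their cylinders, carry an entropy of at least about N c ([entropy_wordp]), even
if only those are kept whose two end letters belong to a large finite set, and
counting occurrences of u in a word gives N mu[u] on average over the words, by
invariance alone ([occ_wordp]).  These are averages over mu, not along orbits,
and so they are the right ones for non-ergodic mu as well.

Loops.  By transitivity each word extends to a loop at a fixed letter by means
of one of finitely many pairs of paths.  The set of end letters, hence these
paths, are chosen before N, so that they cost nothing for large N.

Arrangements.  Loops of different words have different lengths, and one word
has not the right statistics.  Both defects disappear if one takes
floor(K mu[w]) copies of each word w and concatenates them in any order: every
order has the same length T and the same word counts, and for large K the number
of orders is a multinomial coefficient of size about exp(K H), where H is the
entropy of the weights ([many_arrangements]).  This gives D with
ln #|D| >= T (c - e), each element of which has the frequencies of mu.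

Since every element of D is good for itself, D may be replaced by a subset of
cardinal about exp(T c).  This is what bounds the entropies of the approximations
from above.

The measure nu is the law of the concatenation of independent uniformly
distributed loops of D, seen from a uniformly distributed phase in [0, T).
Independent uniform variables are provided by the digits of a number that is
uniformly distributed in [0, 1[ ([pr_digits]).  Then nu is invariant, it is
ergodic as the digits are independent ([concat_measure_ergodic]), and its
entropy is ln #|D| / T by counting names ([concat_measure_entropy]). *)

(** * Cylinders and Borel sets *)

Section cylinders.
Context (A : rel nat) (trA : transitive_matrix A).
Implicit Types (x y : cms trA) (u v : seq nat).

Lemma cms_coord_iter n x i : cms_coord (iter n cms_shift x) i = cms_coord x (n + i).
Proof. by elim: n i => // n IH i; rewrite iterS /cms_coord/= [LHS]IH addnS. Qed.

Lemma cms_coord_inj x y : cms_coord x =1 cms_coord y -> x = y.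
Proof. by move=> e; apply: val_inj; apply/funext => i; exact: e. Qed.

Definition pfx x n := mkseq (cms_coord x) n.
Definition cyl u : set (cms trA) := [set x | pfx x (size u) = u].

Lemma cylP u x : cyl u x <-> forall i, (i < size u)%N -> cms_coord x i = nth 0%N u i.
Proof.
split=> [<- i|h]; first by rewrite size_mkseq => lti; rewrite nth_mkseq.
by apply: (@eq_from_nth _ 0%N); rewrite size_mkseq // => i lti; rewrite nth_mkseq// h.
Qed.

Lemma cms_coord_continuous i : continuous (fun x => cms_coord x i).
Proof.
move=> x; apply: (@continuous_comp (cms trA) {ptws nat -> nat} nat set_val (@proj nat (fun=> nat) i)).
  exact: (@initial_continuous (cms trA) {ptws nat -> nat} set_val).
exact: proj_continuous.
Qed.

Lemma open_coord i (B : set nat) : open [set x : cms trA | B (cms_coord x i)].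
Proof.
have /continuousP := @cms_coord_continuous i; move=> /(_ B); apply; exact: discrete_open.
Qed.

Lemma open_coords n (P : nat -> nat -> Prop) :
  open [set x : cms trA | forall i, (i < n)%N -> P i (cms_coord x i)].
Proof.
elim: n => [|n IH].
  rewrite [X in open X](_ : _ = setT); first exact: openT.
  by apply/seteqP; split.
rewrite [X in open X](_ : _ = [set x : cms trA | forall i, (i < n)%N -> P i (cms_coord x i)] `&`
   [set x : cms trA | P n (cms_coord x n)]).
  by apply: openI => //; exact: open_coord.
apply/seteqP; split=> [x h|x [h1 h2] i] /=.
  by split=> [i lin|]; apply: h => //; exact: ltnW.
by rewrite ltnS leq_eqVlt => /predU1P[->//|]; exact: h1.
Qed.

Lemma open_cyl u : open (cyl u).
Proof.
rewrite (_ : cyl u = [set x : cms trA | forall i, (i < size u)%N -> cms_coord x i = nth 0%N u i]).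
  exact: (@open_coords _ (fun i z => z = nth 0%N u i)).
by apply/seteqP; split=> x /cylP.
Qed.

(** Convergence in the product topology is coordinatewise, so the filter
generated by the sets of sequences sharing n letters with x converges to x. *)
Lemma open_cyl_base (U : set (cms trA)) x : open U -> U x ->
  exists n, cyl (pfx x n) `<=` U.
Proof.
move=> oU Ux; have [W oW WU] := oU.
pose F := filter_from setT (fun n : nat =>
  [set y : {ptws nat -> nat} | forall i, (i < n)%N -> y i = cms_coord x i]).
have FF : Filter F.
  apply: filter_from_filter; first by exists 0%N.
  move=> i j _ _; exists (maxn i j) => // y h; split=> k lk; apply: h.
    exact: leq_trans lk (leq_maxl _ _).
  exact: leq_trans lk (leq_maxr _ _).
have cF : {ptws, F --> (set_val x : nat -> nat)}.
  apply/(@pointwise_cvgP nat nat F _ FF) => i B /nbhs_singleton Bx.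
  by exists i.+1 => // y h; rewrite /= h.
have [n _ h] : F W by apply: cF; apply: open_nbhs_nbhs; split=> //; rewrite -WU in Ux.
exists n => y /cylP ye; rewrite -WU; apply: h => i lin.
by rewrite -[LHS]/(cms_coord y i) ye ?size_mkseq// nth_mkseq.
Qed.

Lemma measurable_open (U : set (cms trA)) : open U -> measurable U.
Proof. by move=> oU; exact: sub_sigma_algebra. Qed.

Lemma measurable_cyl u : measurable (cyl u).
Proof. by apply: measurable_open; exact: open_cyl. Qed.

Lemma measurable_coords n (P : nat -> nat -> Prop) :
  measurable [set x : cms trA | forall i, (i < n)%N -> P i (cms_coord x i)].
Proof. by apply: measurable_open; exact: open_coords. Qed.

(** An enumeration by the natural numbers of the cylinders inside U, padded with
the empty set. *)
Definition cylinder_inside (U : set (cms trA)) (n : nat) : set (cms trA) :=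
  if (unpickle n : option (seq nat)) is Some u then [set x | cyl u x /\ cyl u `<=` U] else set0.

Lemma open_bigcup_cyl (U : set (cms trA)) : open U ->
  U = \bigcup_n cylinder_inside U n.
Proof.
move=> oU; apply/seteqP; split=> [x Ux|x [n _]]; last first.
  by rewrite /cylinder_inside; case: unpickle => // u [ux]; exact.
have [n hn] := open_cyl_base oU Ux.
exists (pickle (pfx x n)) => //; rewrite /cylinder_inside pickleK/=; split=> //.
by rewrite /cyl/= size_mkseq.
Qed.

Lemma cylinder_insideE U n : cylinder_inside U n = set0 \/ exists u, cylinder_inside U n = cyl u.
Proof.
rewrite /cylinder_inside; case: unpickle => [u|]; last by left.
have [uU|nuU] := pselect (cyl u `<=` U); last by left; apply/seteqP; split=> x [].
by right; exists u; apply/seteqP; split=> x // [].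
Qed.

(** An open set is a countable union of cylinders. *)
Lemma measurable_fun_cms d (T : measurableType d) (f : T -> cms trA) :
  (forall u, measurable (f @^-1` cyl u)) -> measurable_fun setT f.
Proof.
move=> mf; apply: (measurability (@open (cms trA))) => //.
move=> _ [U oU <-]; rewrite setTI (open_bigcup_cyl oU) preimage_bigcup.
apply: bigcupT_measurable => n.
by have [->|[u ->]] := cylinder_insideE U n; rewrite ?preimage_set0.
Qed.

Lemma measurable_shift : measurable_fun setT (@cms_shift A trA).
Proof.
apply: measurable_fun_cms => u; apply: measurable_open.
rewrite (_ : _ @^-1` _ = [set x : cms trA | forall i, (i < (size u).+1)%N ->
   (forall j, i = j.+1 -> cms_coord x i = nth 0%N u j)]).
  exact: (@open_coords _ (fun i z => forall j, i = j.+1 -> z = nth 0%N u j)).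
apply/seteqP; split=> x /= => [/cylP h [|i] lti j // [<-]|h]; first by rewrite -h.
by apply/cylP => i lti; exact: h.
Qed.

Lemma measurable_iter_shift n : measurable_fun setT (iter n (@cms_shift A trA)).
Proof.
elim: n => [|n IH]; first exact: measurable_id.
by apply: (@measurableT_comp _ _ _ _ _ _ (@cms_shift A trA)) => //; exact: measurable_shift.
Qed.

Lemma cms_continuous_measurable (R : realType) (f : cms trA -> R) :
  continuous f -> measurable_fun setT f.
Proof.
move=> cf; apply: (measurability _ (RGenOInfty.measurableE R)).
move=> _ [_ [r ->] <-]; rewrite setTI; apply: measurable_open.
by apply: open_comp => //; exact: rray_open.
Qed.

End cylinders.
Arguments cyl {A trA} u.
Arguments pfx {A trA} x n.

(** * Approximation of measurable sets by finite windows *)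

Section window_approximation.
Context (A : rel nat) (trA : transitive_matrix A).
Implicit Types (x y : cms trA) (B : set (cms trA)).

(** The same m bounds the number of letters that are read and the value at which
they are truncated: there are finitely many windows of size m, and one index to
enlarge. *)
Definition agree m x y :=
  forall i, (i < m)%N -> minn (cms_coord x i) m = minn (cms_coord y i) m.

Definition window m B := forall x y, agree m x y -> B x -> B y.

Lemma agree_sym m x y : agree m x y -> agree m y x.
Proof. by move=> h i im; rewrite h. Qed.

Lemma agree_le m n x y : (m <= n)%N -> agree n x y -> agree m x y.
Proof.
move=> mn h i im; have := h i (leq_trans im mn); lia.
Qed.

Lemma window_le m n B : (m <= n)%N -> window m B -> window n B.
Proof. by move=> mn w x y /(agree_le mn); exact: w. Qed.

Lemma window0 : window 0 set0.
Proof. by []. Qed.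

Lemma windowC m B : window m B -> window m (~` B).
Proof. by move=> w x y /agree_sym h nBx By; apply: nBx; exact: w By. Qed.

Lemma windowU m n B B' : window m B -> window n B' -> window (maxn m n) (B `|` B').
Proof.
move=> /(window_le (leq_maxl m n)) w /(window_le (leq_maxr m n)) w' x y h.
by case=> ?; [left; exact: w h _|right; exact: w' h _].
Qed.

(** The sum of the letters of u is at least each of them, so that truncating above
it loses nothing. *)
Lemma window_cyl u : window (size u + sumn u).+1 (@cyl A trA u).
Proof.
move=> x y h /cylP xu; apply/cylP => i lti.
have uis : (nth 0%N u i <= sumn u)%N.
  elim: u i lti {h xu} => // a u IH [|i] /=; first by rewrite leq_addr.
  by rewrite ltnS => /IH h; exact: leq_trans h (leq_addl _ _).
have := h i ltac:(lia); rewrite (xu i lti); lia.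
Qed.

Lemma window_open m B : window m B -> open B.
Proof.
move=> w; rewrite (_ : B = \bigcup_(x in B) cyl (pfx x m)).
  by apply: bigcup_open => x _; exact: open_cyl.
apply/seteqP; split=> [x Bx|x [y By /cylP]].
  by exists x => //; rewrite /cyl/= size_mkseq.
rewrite size_mkseq => xy; apply: w By => i im.
by rewrite xy// nth_mkseq.
Qed.

Lemma window_measurable m B : window m B -> measurable B.
Proof. by move=> /window_open; exact: measurable_open. Qed.

Definition sym_diff B B' := (B `\` B') `|` (B' `\` B).

Lemma sym_diff_measurable B B' : measurable B -> measurable B' ->
  measurable (sym_diff B B').
Proof. by move=> mB mB'; apply: measurableU; exact: measurableD. Qed.

Context (R : realType) (mu : probability (cms trA) R).

Definition approximable B := forall e : R, 0 < e ->
  exists m B', window m B' /\ (mu (sym_diff B B') < e%:E)%E.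

Lemma approximable_window m B : window m B -> approximable B.
Proof.
move=> w e e0; exists m, B; split=> //.
by rewrite /sym_diff setDv setUid measure0 lte_fin.
Qed.

Lemma approximableC B : approximable B -> approximable (~` B).
Proof.
move=> aB e /aB[m [B' [w h]]]; exists m, (~` B'); split; first exact: windowC.
rewrite (_ : sym_diff _ _ = sym_diff B B')//; apply/seteqP; rewrite /sym_diff.
by split=> x /=; have [] := pselect (B x); have [] := pselect (B' x); tauto.
Qed.

Lemma approximable_near B : measurable B ->
  (forall e : R, 0 < e -> exists B0, [/\ measurable B0, approximable B0 & (mu (sym_diff B B0) < e%:E)%E]) ->
  approximable B.
Proof.
move=> mB h e e0; have e2 : 0 < e / 2 by lra.
have [B0 [mB0 /(_ _ e2)[m [B' [w h']]] h0]] := h _ e2.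
exists m, B'; split=> //; have mB' := window_measurable w.
apply: (@le_lt_trans _ _ (mu (sym_diff B B0 `|` sym_diff B0 B'))).
  apply: le_measure; rewrite ?inE; [exact: sym_diff_measurable|by apply: measurableU; exact: sym_diff_measurable|].
  by rewrite /sym_diff => x /=; have [] := pselect (B0 x); tauto.
have m1 : measurable (sym_diff B B0) by exact: sym_diff_measurable.
have m2 : measurable (sym_diff B0 B') by exact: sym_diff_measurable.
by rewrite (le_lt_trans (measureU2 _ m1 m2))// (splitr e) EFinD lteD.
Qed.

Lemma approximableU B B' : measurable B -> measurable B' ->
  approximable B -> approximable B' -> approximable (B `|` B').
Proof.
move=> mB mB' aB aB' e e0; have e2 : 0 < e / 2 by lra.
have [m [C [w h]]] := aB _ e2; have [m' [C' [w' h']]] := aB' _ e2.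
exists (maxn m m'), (C `|` C'); split; first exact: windowU.
have mC := window_measurable w; have mC' := window_measurable w'.
apply: (@le_lt_trans _ _ (mu (sym_diff B C `|` sym_diff B' C'))).
  apply: le_measure; rewrite ?inE; [by apply: sym_diff_measurable; exact: measurableU
    |by apply: measurableU; exact: sym_diff_measurable|].
  by rewrite /sym_diff => x /=; tauto.
have m1 : measurable (sym_diff B C) by exact: sym_diff_measurable.
have m2 : measurable (sym_diff B' C') by exact: sym_diff_measurable.
by rewrite (le_lt_trans (measureU2 _ m1 m2))// (splitr e) EFinD lteD.
Qed.

(** By continuity of mu a countable union is close to a finite one. *)
Lemma approximable_bigcup (F : nat -> set (cms trA)) :
  (forall n, measurable (F n)) -> (forall n, approximable (F n)) ->
  approximable (\bigcup_n F n).
Proof.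
move=> mF aF; apply: approximable_near; first exact: bigcupT_measurable.
move=> e e0; pose G n := \big[setU/set0]_(i < n) F i.
have mG n : measurable (G n) by apply: bigsetU_measurable.
have aG n : approximable (G n).
  elim: n => [|n IH]; first by rewrite /G big_ord0; exact: approximable_window window0.
  by have := approximableU (mG n) (mF n) IH (aF n); rewrite /G big_ord_recr.
have UG : \bigcup_n G n = \bigcup_n F n.
  apply/seteqP; split=> x [n _]; rewrite /G.
    by rewrite -bigcup_mkord => -[i _ Fi]; exists i.
  by exists n.+1 => //; rewrite -bigcup_mkord; exists n => /=.
have mU : measurable (\bigcup_n F n) by exact: bigcupT_measurable.
have : mu \o (fun n => \bigcup_n F n `\` G n) @ \oo --> mu (\bigcap_n (\bigcup_n F n `\` G n)).
  apply: nonincreasing_cvg_mu.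
  - rewrite (le_lt_trans (probability_le1 _ _))// ?ltry//; exact: measurableD.
  - by move=> n; exact: measurableD.
  - by apply: bigcapT_measurable => n; exact: measurableD.
  - move=> n m nm; apply/subsetPset; apply: setDS.
    by rewrite /G; exact: subset_bigsetU.
rewrite (_ : \bigcap_n _ = set0); last first.
  apply/seteqP; split=> x // h; have [+ _] := h 0%N I; rewrite -UG => -[n _ Gx].
  by have [_] := h n I.
rewrite measure0 => /fine_cvgP[] _ /cvgrPdist_lt/(_ _ e0)[n _ /(_ n (leqnn n))].
rewrite /= sub0r normrN ger0_norm ?fine_ge0// => h.
exists (G n); split=> //.
rewrite /sym_diff [X in _ `|` X](_ : _ = set0) ?setU0; last first.
  by apply/seteqP; split=> x //= [Gx []]; rewrite -UG; exists n.
rewrite -(@fineK _ (mu _)) ?lte_fin// fin_num_measure//; exact: measurableD.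
Qed.

(** The approximable measurable sets form a sigma-algebra that contains the
cylinders. *)
Lemma approximable_measurable B : measurable B -> approximable B.
Proof.
suff: (@open (cms trA)).-sigma.-measurable `<=` [set B | measurable B /\ approximable B].
  by move=> h /h[].
apply: smallest_sub.
  split=> [|B' [mB' aB']|F h] /=.
  - by split=> //; exact: approximable_window window0.
  - by rewrite setTD; split; [exact: measurableC|exact: approximableC].
  - split; first by apply: bigcupT_measurable => n; have [] := h n.
    by apply: approximable_bigcup => n; have [] := h n.
move=> U oU; split; first exact: measurable_open.
rewrite (open_bigcup_cyl oU); apply: approximable_bigcup => n.
  by have [->//|[u ->]] := cylinder_insideE U n; exact: measurable_cyl.
have [->|[u ->]] := cylinder_insideE U n; first exact: approximable_window window0.
by apply: approximable_window; exact: window_cyl.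
Qed.

End window_approximation.

(** * Entropy of finite laws *)

Section shannon.
Context (R : realType).

Definition entropy (I : finType) (p : I -> R) : R := - \sum_i p i * ln (p i).

Lemma ln_le_sub1 (x : R) : 0 < x -> ln x <= x - 1.
Proof. by move=> x0; have := @le_ln1Dx R (x - 1); rewrite subrKC; apply; lra. Qed.

(** Gibbs' inequality, from ln x <= x - 1 at x = r i / p i.  It is the source of
all upper bounds on entropies below: one only has to exhibit a weight r. *)
Lemma gibbs (I : finType) (p r : I -> R) : (forall i, 0 <= p i) ->
  (forall i, 0 <= r i) -> (forall i, 0 < p i -> 0 < r i) ->
  \sum_i p i * ln (r i) <= \sum_i p i * ln (p i) + (\sum_i r i - \sum_i p i).
Proof.
move=> p0 r0 pr; rewrite -sumrB -big_split/=; apply: ler_sum => i _.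
have := p0 i; rewrite le_eqVlt => /predU1P[<-|pi0]; first by rewrite !mul0r add0r subr0.
have ri0 := pr _ pi0; have h : 0 < r i / p i by rewrite divr_gt0.
have : p i * (ln (r i) - ln (p i)) <= p i * (r i / p i - 1).
  by rewrite ler_pM2l// -ln_div ?posrE// ln_le_sub1.
by rewrite !mulrBr mulr1 mulrCA divff ?gt_eqF// mulr1; lra.
Qed.

Lemma entropy_gibbs (I : finType) (p r : I -> R) : (forall i, 0 <= p i) ->
  (forall i, 0 <= r i) -> (forall i, 0 < p i -> 0 < r i) ->
  \sum_i r i <= \sum_i p i -> entropy p <= - \sum_i p i * ln (r i).
Proof.
by move=> p0 r0 pr h; have := gibbs p0 r0 pr; rewrite /entropy; lra.
Qed.

(** Gibbs' inequality for the constant weight.  The total mass may be less than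
1, as it will be for the part of a law carried by exceptional words. *)
Lemma entropy_le_card (I : finType) (p : I -> R) : (forall i, 0 <= p i) ->
  \sum_i p i <= 1 -> entropy p <= (\sum_i p i) * ln #|I|%:R + (1 - \sum_i p i).
Proof.
move=> p0 p1; have [I0|I0] := posnP #|I|.
  rewrite /entropy !big_pred0 => [|i|i]; last 2 first.
  - by have := fintype0 i I0.
  - by have := fintype0 i I0.
  by rewrite mul0r; lra.
have I0' : 0 < #|I|%:R^-1 :> R by rewrite invr_gt0 ltr0n.
have := @gibbs I p (fun=> #|I|%:R^-1) p0 (fun=> ltW I0') (fun _ _ => I0').
have -> : \sum_(i in I) #|I|%:R^-1 = 1 :> R.
  by rewrite sumr_const -[LHS]mulr_natl divff// pnatr_eq0 -lt0n.
by rewrite -mulr_suml lnV ?posrE ?ltr0n// /entropy; lra.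
Qed.

Lemma entropy_ge (I : finType) (p : I -> R) (b : R) : (forall i, 0 <= p i) ->
  (forall i, p i <= b) -> \sum_i p i = 1 -> - ln b <= entropy p.
Proof.
move=> p0 pb p1; rewrite /entropy lerNl opprK -[leRHS]mul1r -p1 mulr_suml.
apply: ler_sum => i _.
have := p0 i; rewrite le_eqVlt => /predU1P[<-|pi0]; first by rewrite !mul0r.
by rewrite ler_wpM2l ?p0// ler_ln ?posrE// (lt_le_trans pi0).
Qed.

Lemma entropy_ge0 (I : finType) (p : I -> R) : (forall i, 0 <= p i <= 1) -> 0 <= entropy p.
Proof.
move=> p01; rewrite /entropy -sumrN sumr_ge0// => i _; have /andP[p0 p1] := p01 i.
by rewrite -mulrN mulr_ge0// oppr_ge0 ln_le0.
Qed.

Lemma xlnxD (x y : R) : 0 <= x -> 0 <= y -> x * ln x + y * ln y <= (x + y) * ln (x + y).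
Proof.
move=> x0 y0; rewrite mulrDl lerD//.
  move: x0; rewrite le_eqVlt => /predU1P[<-|x0]; first by rewrite !mul0r.
  by rewrite ler_wpM2l ?ler_ln ?posrE ?(ltW x0)//; lra.
move: y0; rewrite le_eqVlt => /predU1P[<-|y0]; first by rewrite !mul0r.
by rewrite ler_wpM2l ?ler_ln ?posrE ?(ltW y0)//; lra.
Qed.

(** Superadditivity of x ln x: merging atoms decreases the entropy. *)
Lemma xlnx_sum (I : finType) (P : pred I) (p : I -> R) : (forall i, 0 <= p i) ->
  \sum_(i | P i) p i * ln (p i) <= (\sum_(i | P i) p i) * ln (\sum_(i | P i) p i).
Proof.
move=> p0; pose K (a b : R) := 0 <= b /\ a <= b * ln b.
suff [] : K (\sum_(i | P i) p i * ln (p i)) (\sum_(i | P i) p i) by [].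
apply: (big_ind2 K) => [|a b a' b' [b0 h] [b0' h']|i _]; rewrite /K ?mul0r ?p0//.
by split; [exact: addr_ge0|rewrite (le_trans _ (xlnxD b0 b0'))// lerD].
Qed.

End shannon.

Section finite_valued_maps.
Context d (T : measurableType d).

Definition fin_measurable (I : finType) (F : T -> I) := forall i, measurable (F @^-1` [set i]).

Lemma preimage_cons (I : finType) (F : T -> I) i (s : seq I) :
  [set x | F x \in i :: s] = F @^-1` [set i] `|` [set x | F x \in s].
Proof.
apply/seteqP; split=> x /=; rewrite in_cons; first by case/predU1P; [left|right].
by case=> [->|->]; rewrite ?eqxx ?orbT.
Qed.

Lemma measurable_mem (I : finType) (F : T -> I) (s : seq I) : fin_measurable F ->
  measurable [set x | F x \in s].
Proof.
move=> mF; elim: s => [|i s IH]; last by rewrite preimage_cons; exact: measurableU.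
by rewrite (_ : [set x | _] = set0)//; apply/seteqP; split.
Qed.

Lemma measurable_pred (I : finType) (F : T -> I) (P : pred I) : fin_measurable F ->
  measurable [set x | P (F x)].
Proof.
move=> /(@measurable_mem _ _ (enum P)).
by congr measurable; apply/seteqP; split=> x /=; rewrite mem_enum.
Qed.

Lemma fin_measurable_asbool (B : set T) : measurable B -> fin_measurable (fun x => `[< B x >]).
Proof.
move=> mB [].
  by rewrite (_ : _ @^-1` _ = B)//; apply/seteqP; split=> x /= /asboolP.
rewrite (_ : _ @^-1` _ = ~` B); first exact: measurableC.
by apply/seteqP; split=> x /=; [move=> /asboolPn|move=> h; apply/asboolPn].
Qed.

Lemma fin_measurable_pair (I J : finType) (F : T -> I) (G : T -> J) :
  fin_measurable F -> fin_measurable G -> fin_measurable (fun x => (F x, G x)).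
Proof.
move=> mF mG [i j]; rewrite (_ : _ @^-1` _ = F @^-1` [set i] `&` G @^-1` [set j]).
  exact: measurableI.
by apply/seteqP; split=> x /= [-> ->].
Qed.

Lemma fin_measurable_ffun n (I : finType) (F : nat -> T -> I) :
  (forall i, fin_measurable (F i)) -> fin_measurable (fun x => [ffun i : 'I_n => F i x]).
Proof.
move=> mF w; rewrite (_ : _ @^-1` _ = \bigcap_k
    (if insub k is Some i then F k @^-1` [set w i] else setT)).
  by apply: bigcapT_measurable => k; case: insubP => [i _ _|_]; [exact: mF|exact: measurableT].
apply/seteqP; split=> x /= h.
  by move=> k _; case: insubP => // i _ <- /=; rewrite -h ffunE.
apply/ffunP => i; rewrite ffunE; have := h i Logic.I.
by case: insubP => [j _ /val_inj <-//|]; rewrite ltn_ord.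
Qed.

Lemma measurable_neq (I : finType) (F G : T -> I) : fin_measurable F -> fin_measurable G ->
  measurable [set x | F x != G x].
Proof.
move=> mF mG.
by have := measurable_pred (fun z : I * I => z.1 != z.2) (fin_measurable_pair mF mG).
Qed.

End finite_valued_maps.

Section laws.
Context d (T : measurableType d) (R : realType) (mu : probability T R).

Definition law (I : finType) (F : T -> I) (i : I) : R := fine (mu (F @^-1` [set i])).

Definition pr (B : set T) : R := fine (mu B).

Lemma prE B : measurable B -> mu B = (pr B)%:E.
Proof. by move=> mB; rewrite fineK// fin_num_measure. Qed.

Lemma pr_ge0 B : 0 <= pr B. Proof. by rewrite /pr fine_ge0. Qed.

Lemma pr_le1 B : measurable B -> pr B <= 1.
Proof. by move=> mB; rewrite -lee_fin -prE// probability_le1. Qed.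

Lemma pr_setT : pr setT = 1. Proof. by rewrite /pr probability_setT. Qed.

Lemma pr_eq0 B : (forall x, ~ B x) -> pr B = 0.
Proof.
move=> B0; rewrite /pr (_ : B = set0) ?measure0//.
by apply/seteqP; split=> x // /B0.
Qed.

Lemma le_pr B C : measurable B -> measurable C -> B `<=` C -> pr B <= pr C.
Proof. by move=> mB mC BC; rewrite -lee_fin -!prE// le_measure ?inE. Qed.

Lemma prU B C : measurable B -> measurable C -> pr (B `|` C) <= pr B + pr C.
Proof.
move=> mB mC; rewrite -lee_fin EFinD -!prE//; first exact: measureU2.
exact: measurableU.
Qed.

Lemma law_ge0 (I : finType) (F : T -> I) i : 0 <= law F i.
Proof. exact: pr_ge0. Qed.

Lemma law_le1 (I : finType) (F : T -> I) i : fin_measurable F -> law F i <= 1.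
Proof. by move=> mF; exact: pr_le1. Qed.

Lemma pr_pred (I : finType) (F : T -> I) (P : pred I) : fin_measurable F ->
  pr [set x | P (F x)] = \sum_(i | P i) law F i.
Proof.
move=> mF; rewrite -big_enum (_ : [set x | _] = [set x | F x \in enum P]); last first.
  by apply/seteqP; split=> x /=; rewrite mem_enum.
elim: (enum P) (enum_uniq P) => [_|i s IH /= /andP[nis /IH IHs]].
  by rewrite big_nil pr_eq0.
have mS := measurable_mem s mF.
rewrite big_cons -IHs; apply: EFin_inj; rewrite EFinD -!prE//; last exact: measurable_mem.
rewrite preimage_cons measureU// -?prE//; apply/seteqP; split=> x //= -[->].
by rewrite (negbTE nis).
Qed.

Lemma law_sum (I : finType) (F : T -> I) : fin_measurable F -> \sum_i law F i = 1.
Proof. by move=> mF; rewrite -(pr_pred xpredT mF) -pr_setT; congr pr; apply/seteqP. Qed.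

Lemma law_comp (I J : finType) (F : T -> I) (g : I -> J) j : fin_measurable F ->
  law (g \o F) j = \sum_(i | g i == j) law F i.
Proof.
move=> mF; rewrite -(pr_pred (fun i => g i == j) mF).
by congr pr; apply/seteqP; split=> x /= /eqP.
Qed.

Lemma pr_partition (I : finType) (F : T -> I) B : fin_measurable F -> measurable B ->
  pr B = \sum_i pr [set x | F x = i /\ B x].
Proof.
move=> mF mB; have mP := fin_measurable_pair mF (fin_measurable_asbool mB).
have := pr_pred snd mP; rewrite (_ : [set x | _] = B); last first.
  by apply/seteqP; split=> x /= /asboolP.
move=> ->; rewrite big_mkcond/= (eq_bigr (fun z : I * bool =>
    if z.2 then law (fun x => (F x, `[< B x >])) (z.1, z.2) else 0)) => [|[] //].
rewrite -(pair_bigA _ (fun i (b : bool) => if b then law (fun x => (F x, `[< B x >])) (i, b) else 0))/=.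
apply: eq_bigr => i _; rewrite big_bool/= addr0; congr pr.
by apply/seteqP; split=> x /= [->]; [move/asboolP|move=> h; rewrite asboolT].
Qed.

Lemma entropy_law_comp (I J : finType) (F : T -> I) (g : I -> J) : fin_measurable F ->
  entropy (law (g \o F)) <= entropy (law F).
Proof.
move=> mF; rewrite /entropy lerN2 (partition_big g xpredT)//=; apply: ler_sum => j _.
by rewrite law_comp//; apply: xlnx_sum => i; exact: law_ge0.
Qed.

Lemma entropy_law_factor (I J : finType) (F : T -> I) (G : T -> J) : fin_measurable F ->
  (forall x y, F x = F y -> G x = G y) -> entropy (law G) <= entropy (law F).
Proof.
move=> mF FG; pose g i := if pselect (exists x, F x = i) is left h then G (projT1 (cid h)) else G point.
suff -> : G = g \o F by exact: entropy_law_comp.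
apply/funext => x /=; rewrite /g; case: pselect => [h|[]]; last by exists x.
by apply: FG; case: cid.
Qed.

Lemma entropy_law_le_card (I : finType) (F : T -> I) : fin_measurable F ->
  entropy (law F) <= ln #|I|%:R.
Proof.
move=> mF; have := @entropy_le_card R I (law F) (law_ge0 F).
by rewrite law_sum// mul1r subrr addr0; apply.
Qed.

End laws.

(** * Comparing the itineraries of two partitions *)

Section joins.
Context d (T : measurableType d) (R : realType) (mu : probability T R) (f : T -> T).
Hypothesis mf : measurable_fun setT f.
Hypothesis invf : invariant_measure f mu.

Definition itinerary k (P : T -> 'I_k) n (x : T) : {ffun 'I_n -> 'I_k} :=
  [ffun i : 'I_n => P (iter i f x)].

Lemma join_pieceE k (P : T -> 'I_k) n (w : {ffun 'I_n -> 'I_k}) :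
  join_piece f P w = @itinerary k P n @^-1` [set w].
Proof.
apply/seteqP; split=> x /= h; first by apply/ffunP => i; rewrite ffunE.
by move=> i; rewrite -h ffunE.
Qed.

Lemma join_entropyE k (P : T -> 'I_k) n :
  join_entropy f mu P n = entropy (law mu (@itinerary k P n)).
Proof.
by rewrite /join_entropy /entropy; congr (- _); apply: eq_bigr => w _; rewrite join_pieceE.
Qed.

Lemma measurable_iter n : measurable_fun setT (iter n f).
Proof. by elim: n => [|n IH]; [exact: measurable_id|exact: (measurableT_comp mf IH)]. Qed.

Lemma fin_measurable_iter (I : finType) (P : T -> I) n :
  fin_measurable P -> fin_measurable (P \o iter n f).
Proof.
by move=> mP i; have := @measurable_iter n measurableT _ (mP i); rewrite setTI.
Qed.

Lemma fin_measurable_itinerary k (P : T -> 'I_k) n :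
  fin_measurable P -> fin_measurable (@itinerary k P n).
Proof.
move=> mP; apply: (@fin_measurable_ffun _ _ n _ (fun i => P \o iter i f)) => i.
exact: fin_measurable_iter.
Qed.

Lemma pr_iter n B : measurable B -> pr mu [set x | B (iter n f x)] = pr mu B.
Proof.
move=> mB; elim: n => // n <-; rewrite /pr; congr fine.
rewrite -[RHS]invf; first by congr (mu _); apply/seteqP; split=> x /=; rewrite -iterSr.
by have := @measurable_iter n measurableT _ mB; rewrite setTI.
Qed.

(** If Q is rarely different from Q', and if n iterates of Q' are a function of
Y, then the itinerary of Q is determined by Y up to few errors.  To turn this
into a bound, Gibbs' inequality is applied to the joint law of Y and of the
itinerary, with the weight that draws Y from its law and then, independently at
each time i, the value g i Y with weight 1 - t and every other value with weight
t / q. *)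
Lemma join_entropy_approx q (Q Q' : T -> 'I_q) n (J : finType) (Y : T -> J)
    (g : nat -> J -> 'I_q) (t : R) :
  fin_measurable Q -> fin_measurable Q' -> fin_measurable Y ->
  (forall x i, (i < n)%N -> Q' (iter i f x) = g i (Y x)) -> 0 < t < 1 ->
  join_entropy f mu Q n <= entropy (law mu Y) +
    n%:R * (- ln (1 - t) + pr mu [set x | Q x != Q' x] * ln (q%:R / t)).
Proof.
move=> mQ mQ' mY Q'g /andP[t0 t1].
have q0 : (0 < q)%N by apply: leq_ltn_trans (ltn_ord (Q point)).
pose W x := (Y x, @itinerary q Q n x).
have mI : fin_measurable (@itinerary q Q n) by exact: fin_measurable_itinerary.
have mW : fin_measurable W := fin_measurable_pair mY mI.
rewrite join_entropyE (le_trans (@entropy_law_comp _ _ _ _ _ _ W snd mW))//.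
pose rho (b : bool) : R := if b then 1 - t else t / q%:R.
have rho0 b : 0 < rho b by rewrite /rho; case: b; rewrite ?divr_gt0 ?ltr0n//; lra.
pose r (z : J * {ffun 'I_n -> 'I_q}) := law mu Y z.1 * \prod_i rho (z.2 i == g i z.1).
(* the weight of Gibbs' inequality is [r]; its total is at most 1 because rho
   sums to at most 1 over the values of the partition *)
have prod0 (z : J * {ffun 'I_n -> 'I_q}) : 0 < \prod_(i < n) rho (z.2 i == g i z.1) by apply: prodr_gt0.
have YW y : law mu Y y = \sum_(v : {ffun 'I_n -> 'I_q}) law mu W (y, v).
  rewrite -[Y]/(fst \o W) law_comp// (reindex (fun v => (y, v)))/=.
    by apply: eq_bigl => v /=; rewrite eqxx.
  by exists snd => [v//|[y' v]] /=; rewrite inE => /eqP <-.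
have posY z : 0 < law mu W z -> 0 < law mu Y z.1.
  move=> h; apply: (lt_le_trans h); rewrite YW (bigD1 z.2)//= -surjective_pairing lerDl.
  by apply: sumr_ge0 => v _; exact: law_ge0.
have r_sum : \sum_z r z <= 1.
  rewrite -(pair_bigA _ (fun y v => r (y, v)))/= -(law_sum mu mY); apply: ler_sum => y _.
  rewrite /r/= -mulr_sumr -[leRHS]mulr1 ler_wpM2l ?law_ge0//.
  rewrite -(bigA_distr_bigA (fun (i : 'I_n) (a : 'I_q) => rho (a == g i y))) prodr_ile1// => i.
  rewrite sumr_ge0/= => [|a _]; last exact: ltW.
  rewrite (bigD1 (g i y))//= eqxx {1}/rho.
  under eq_bigr => a /negPf -> do rewrite /rho.
  rewrite sumr_const -[X in _ + X]mulr_natl mulrCA.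
  rewrite -lerBrDl opprB addrCA subrr addr0 -[leRHS]mulr1 ler_pM2l//.
  rewrite ler_pdivrMr ?ltr0n// mul1r ler_nat.
  by rewrite (leq_trans (max_card _))// card_ord.
apply: (le_trans (entropy_gibbs (law_ge0 _ _) _ _ _ (r := r))).
- by move=> z; apply: mulr_ge0; [exact: law_ge0|exact/ltW/prod0].
- by move=> z /posY h; apply: mulr_gt0 => //; exact: prod0.
- by rewrite law_sum.
have lnr z : law mu W z * ln (r z) = law mu W z * ln (law mu Y z.1) +
    \sum_(i < n) law mu W z * ln (rho (z.2 i == g i z.1)).
  have := law_ge0 mu W z; rewrite le_eqVlt => /predU1P[<-|h].
    by rewrite !mul0r add0r big1// => i _; rewrite mul0r.
  rewrite /r lnM ?posrE ?posY// mulrDr; congr (_ + _); rewrite -mulr_sumr; congr (_ * _).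
  pose K (a b : R) := 0 < a /\ ln a = b.
  suff [] : K (\prod_(i < n) rho (z.2 i == g i z.1)) (\sum_(i < n) ln (rho (z.2 i == g i z.1))) by [].
  apply: (big_ind2 K) => [|a b a' b' [a0 <-] [a0' <-]|i _]; rewrite /K ?ln1 ?rho0//.
  by rewrite mulr_gt0// lnM.
under eq_bigr => z _ do rewrite lnr.
rewrite big_split/= opprD lerD//.
  rewrite /entropy lerN2.
  have -> : \sum_z law mu W z * ln (law mu Y z.1) =
      \sum_z law mu W (z.1, z.2) * ln (law mu Y z.1) by apply: eq_bigr => -[].
  rewrite -(pair_bigA _ (fun y v => law mu W (y, v) * ln (law mu Y y)))/=.
  by apply: ler_sum => y _; rewrite -mulr_suml -YW.
rewrite exchange_big/= -sumrN [leRHS]mulr_natl -[X in _ *+ X](card_ord n) -sumr_const.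
apply: ler_sum => i _.
have -> : pr mu [set x | Q x != Q' x] = \sum_(z : J * {ffun 'I_n -> 'I_q} | z.2 i != g i z.1) law mu W z.
  rewrite -(pr_pred mu (fun z : J * {ffun 'I_n -> 'I_q} => z.2 i != g i z.1) mW) -(pr_iter i (measurable_neq mQ mQ')).
  by congr pr; apply/seteqP; split=> x /=; rewrite ffunE Q'g.
rewrite mulr_suml -[X in _ <= X + _]mul1r -[X in _ <= X * _ + _](law_sum mu mW) mulr_suml [X in _ <= _ + X]big_mkcond/=.
rewrite -big_split/= -sumrN; apply: ler_sum => z _; rewrite -mulrN.
have ln1t : ln (1 - t) <= 0 by apply: ln_le0; lra.
case: ifPn => [/negPf ->|/negPn/eqP ->]; last by rewrite eqxx addr0 /rho.
rewrite -mulrDr ler_wpM2l ?law_ge0// /rho -invf_div lnV ?posrE ?divr_gt0 ?ltr0n// opprK.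
by lra.
Qed.

End joins.

(** * The partitions by the truncated first letter *)

Section generating.
Context (A : rel nat) (trA : transitive_matrix A) (R : realType).
Context (mu : probability (cms trA) R).
Implicit Types x y : cms trA.

Definition alpha M (x : cms trA) : 'I_M.+1 := inord (minn (cms_coord x 0) M).

Lemma alpha_val M x : alpha M x = minn (cms_coord x 0) M :> nat.
Proof. by rewrite /alpha inordK// ltnS geq_minr. Qed.

Lemma alpha_iter M x i : alpha M (iter i cms_shift x) = minn (cms_coord x i) M :> nat.
Proof. by rewrite alpha_val cms_coord_iter addn0. Qed.

Lemma fin_measurable_window m (I : finType) (F : cms trA -> I) :
  (forall x y, agree m x y -> F x = F y) -> fin_measurable F.
Proof.
by move=> h i; apply: (@window_measurable _ _ m) => x y /h /= ->.
Qed.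

Lemma fin_measurable_alpha M : fin_measurable (alpha M).
Proof.
apply: (@fin_measurable_window M.+1) => x y /(_ 0%N isT) h.
by apply: val_inj => /=; rewrite !alpha_val; lia.
Qed.

Lemma pr_bigU (I : Type) (s : seq I) (F : I -> set (cms trA)) : (forall i, measurable (F i)) ->
  pr mu (\big[setU/set0]_(i <- s) F i) <= \sum_(i <- s) pr mu (F i).
Proof.
move=> mF; elim: s => [|i s IH]; first by rewrite !big_nil /pr measure0.
rewrite !big_cons (le_trans (prU _ _ _))//; first exact: bigsetU_measurable.
by rewrite lerD2l.
Qed.

(** The approximations of the pieces of Q may overlap or miss some points: Q'
chooses one that contains the point, by a rule that only depends on which ones
do. *)
Lemma approximate_partition q (Q : cms trA -> 'I_q) (e : R) : fin_measurable Q -> 0 < e ->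
  exists m (Q' : cms trA -> 'I_q), (forall x y, agree m x y -> Q' x = Q' y) /\
    pr mu [set x | Q x != Q' x] <= e.
Proof.
move=> mQ e0; have q0 : (0 < q)%N by apply: leq_ltn_trans (ltn_ord (Q point)).
have eq0 : 0 < e / q%:R by rewrite divr_gt0// ltr0n.
have /choice[W hW] i := approximable_measurable mu (mQ i) eq0.
have /choice[B hB] := hW; pose m := (\max_i W i)%N.
have wB i : window m (B i).
  exact: window_le (leq_bigmax i) (hB i).1.
pose Q' x := odflt (Q point) [pick i | `[< B i x >]].
have Q'm x y : agree m x y -> Q' x = Q' y.
  move=> xy; rewrite /Q'.
  have BE i : `[< B i x >] = `[< B i y >].
    by apply/asboolP/asboolP; apply: wB => //; exact: agree_sym.
  by rewrite (eq_pick BE).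
exists m, Q'; split=> //.
have mS i : measurable (sym_diff (Q @^-1` [set i]) (B i)).
  by apply: sym_diff_measurable => //; exact: window_measurable.
have mQ' : fin_measurable Q' := fin_measurable_window Q'm.
apply: (@le_trans _ _ (pr mu (\big[setU/set0]_(i : 'I_q) sym_diff (Q @^-1` [set i]) (B i)))).
  apply: le_pr => //; first exact: measurable_neq.
    exact: bigsetU_measurable.
  move=> x /= nQ; apply: contrapT => nx; move/negP: nQ; apply.
  have nS i : ~ sym_diff (Q @^-1` [set i]) (B i) x.
    by move=> h; apply: nx; rewrite (bigD1 i)//=; left.
  have BQ i : B i x <-> Q x = i.
    have := nS i; rewrite /sym_diff/=; have [] := pselect (B i x); have [] := pselect (Q x = i); tauto.
  rewrite /Q'; case: pickP => [i /asboolP/BQ -> //|/(_ (Q x))/asboolP] h.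
  by case: h; apply/BQ.
rewrite (le_trans (pr_bigU _ mS))// (@le_trans _ _ (\sum_(i : 'I_q) e / q%:R))//.
  apply: ler_sum => i _; rewrite ltW// -lte_fin -prE//; exact: (hB i).2.
by rewrite sumr_const card_ord -[leLHS]mulr_natr divfK// pnatr_eq0 -lt0n.
Qed.

(** The finite partitions [alpha m] generate: this is the part of the
Kolmogorov-Sinai theorem that is needed, stated before taking limits.  The bound
follows from [join_entropy_approx], as n iterates of a function of the window of
size m are a function of n + m truncated letters. *)
Lemma join_entropy_le_alpha q (Q : cms trA -> 'I_q) (e : R) :
  invariant_measure cms_shift mu -> fin_measurable Q -> 0 < e ->
  exists m, forall n, join_entropy cms_shift mu Q n <=
     join_entropy cms_shift mu (alpha m) (n + m) + n%:R * e.
Proof.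
move=> inv mQ e0; have q0 : (0 < q)%N by apply: leq_ltn_trans (ltn_ord (Q point)).
(* t makes - ln (1 - t) equal to e / 2, and d is the error on Q that leaves at
   most e / 2 for the other term *)
pose t : R := 1 - expR (- (e / 2)).
have t01 : 0 < t < 1.
  have := @expR_gt0 R (- (e / 2)).
  have : expR (- (e / 2)) < 1 :> R by rewrite expR_lt1; lra.
  by rewrite /t; lra.
have [t0 t1] := andP t01.
have l0 : 0 <= ln (q%:R / t).
  apply: ln_ge0; rewrite ler_pdivlMr// mul1r (le_trans (ltW t1))//.
  by rewrite ler1n.
pose d := e / 2 / (ln (q%:R / t) + 1).
have d0 : 0 < d by rewrite !divr_gt0//; lra.
have [m [Q' [Q'm hQ']]] := approximate_partition mQ d0.
exists m => n; set Y := @itinerary _ (cms trA) cms_shift m.+1 (alpha m) (n + m).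
pose g i w := match pselect (exists x, Y x = w) with
  | left h => Q' (iter i cms_shift (projT1 (cid h))) | right _ => Q point end.
have Yg x i : (i < n)%N -> Q' (iter i cms_shift x) = g i (Y x).
  move=> lin; rewrite /g; case: pselect => [h|[]]; last by exists x.
  case: cid => x' /= /ffunP Yx; apply: Q'm => j jm.
  have lt : (i + j < n + m)%N by lia.
  move: (Yx (Ordinal lt)); rewrite !ffunE => /(congr1 val)/=.
  by rewrite !alpha_iter !cms_coord_iter.
have mY : fin_measurable Y.
  by apply: fin_measurable_itinerary; [exact: measurable_shift|exact: fin_measurable_alpha].
have := join_entropy_approx (@measurable_shift _ trA) inv mQ (fin_measurable_window Q'm) mY Yg t01.
move=> /le_trans; apply; rewrite join_entropyE lerD2l ler_wpM2l//.
rewrite /t opprB subrKC expRK opprK.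
have : pr mu [set x | Q x != Q' x] * ln (q%:R / t) <= d * (ln (q%:R / t) + 1).
  by apply: ler_pM => //; [exact: pr_ge0|lra].
rewrite /d divfK; last by rewrite gt_eqF//; lra.
by rewrite /t; lra.
Qed.

End generating.
Arguments alpha {A trA} M x.

(** * Counting the arrangements of a multiset of words *)

Section occurrences.
Local Open Scope nat_scope.

Definition occ (u s : seq nat) : nat := \sum_(j < size s) prefix u (drop j s).

Lemma occ_cat u s t : occ u s + occ u t <= occ u (s ++ t).
Proof.
rewrite /occ size_cat big_split_ord/=; apply: leq_add; apply: leq_sum => j _ /=.
  rewrite drop_cat ltn_ord; case pu: (prefix u (drop j s)) => //.
  by rewrite (prefix_trans pu) ?prefix_prefix.
by rewrite drop_cat ltnNge leq_addr/= addKn.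
Qed.

Lemma occ_le_size u s : occ u s <= size s.
Proof. by rewrite /occ -[leqRHS]card_ord -sum1_card leq_sum// => j _; case: prefix. Qed.

Lemma occ_flatten u ss : \sum_(s <- ss) occ u s <= occ u (flatten ss).
Proof.
elim: ss => [|s ss IH]; first by rewrite big_nil.
by rewrite big_cons/= (leq_trans _ (occ_cat _ _ _))// leq_add2l.
Qed.

Lemma sum_count_mem (I : finType) (s : seq I) : \sum_i count_mem i s = size s.
Proof.
elim: s => [|x s IH]; first by rewrite big1.
under eq_bigr do rewrite /= eq_sym.
rewrite big_split/= IH -[RHS]add1n; congr (_ + _).
by rewrite (bigD1 x)//= eqxx big1// => i /negPf ->.
Qed.

Lemma sum_map_count (I : finType) (F : I -> nat) (s : seq I) :
  \sum_(i <- s) F i = \sum_i count_mem i s * F i.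
Proof.
elim: s => [|x s IH]; first by rewrite big_nil big1.
rewrite big_cons IH; under [RHS]eq_bigr do rewrite /= mulnDl.
rewrite big_split/=; congr (_ + _).
by rewrite (bigD1 x)//= eqxx mul1n big1 ?addn0// => i; rewrite eq_sym => /negPf ->.
Qed.

(** A multiset of size n has at least n! divided by the product of the
factorials of its multiplicities as arrangements: sort the arrangements by their
first element. *)
Lemma fact_le_permutations (I : finType) (s : seq I) :
  (size s)`! <= size (permutations s) * \prod_i (count_mem i s)`!.
Proof.
have [n] := ubnP (size s); elim: n s => // n IH s; rewrite ltnS => sn.
have [/size0nil->|s0] := posnP (size s); first by rewrite /= big1.
rewrite (perm_size (permutationsE s0)) size_allpairs_dep sumnE big_map.
rewrite big_distrl/= -[X in X`!](prednK s0) factS (prednK s0) -{1}(sum_count_mem s) big_distrl/=.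
rewrite [leqRHS]big_uniq ?undup_uniq//= (bigID (mem (undup s)))/= [X in _ + X]big1 ?addn0; last first.
  by move=> i; rewrite /= mem_undup => nis; rewrite (count_memPn nis).
apply: leq_sum => x; rewrite mem_undup => xs.
have c0 : 0 < count_mem x s by rewrite -has_count has_pred1.
have -> : \prod_i (count_mem i s)`! = count_mem x s * \prod_i (count_mem i (rem x s))`!.
  rewrite (bigD1 x)//= [in RHS](bigD1 x)//= count_mem_rem eqxx subn1 mulnA.
  rewrite -{1}(prednK c0) factS (prednK c0); congr (_ * _).
  by apply: eq_bigr => i ix; rewrite count_mem_rem eq_sym (negPf ix) subn0.
rewrite mulnCA leq_mul2l -(size_rem xs) IH ?orbT// size_rem//.
by rewrite prednK.
Qed.

(** A concatenation of words of different lengths may be ambiguous.  It can be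
decoded from left to right if one knows colours that determine the lengths. *)
Lemma decode_flatten (I J : eqType) (l : I -> seq nat) (c : I -> J) (s t : seq I) :
  (forall i j, c i = c j -> size (l i) = size (l j)) ->
  (forall i j, c i = c j -> l i = l j -> i = j) ->
  map c s = map c t -> flatten (map l s) = flatten (map l t) -> s = t.
Proof.
move=> cl inj; elim: s t => [|i s IH] [|j t]//= [cij cst] /eqP.
rewrite eqseq_cat ?(cl _ _ cij)// => /andP[/eqP lij /eqP lst].
by rewrite (inj i j)// (IH t).
Qed.

Definition arrangements (I : finType) (l : I -> seq nat) (s : seq I) : seq (seq nat) :=
  undup [seq flatten (map l t) | t <- permutations s].

(** Forgetting the colours costs at most their number to the power of the number
of words: too little to matter, as the words are long. *)
Lemma size_permutations_le (I J : finType) (l : I -> seq nat) (c : I -> J) (s : seq I) :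
  (forall i j, c i = c j -> size (l i) = size (l j)) ->
  (forall i j, c i = c j -> l i = l j -> i = j) ->
  size (permutations s) <= size (arrangements l s) * #|J| ^ size s.
Proof.
move=> cl inj; pose D := arrangements l s.
pose C := [seq val x | x : (size s).-tuple J].
have -> : #|J| ^ size s = size C by rewrite size_image card_tuple.
rewrite -(size_allpairs (fun d x => (d, x))) -(size_map (fun t => (flatten (map l t), map c t))).
apply: uniq_leq_size.
  rewrite map_inj_in_uniq ?permutations_uniq// => t t'.
  by move=> _ _ [e1 e2]; exact: decode_flatten cl inj e2 e1.
move=> _ /mapP[t tp ->]; apply/allpairsP; exists (flatten (map l t), map c t); split=> //=.
  by rewrite mem_undup; apply/mapP; exists t.
have st : size (map c t) == size s by rewrite size_map (perm_size (_ : perm_eq t s)) ?mem_permutations// -mem_permutations.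
by apply/mapP; exists (Tuple st); rewrite ?mem_enum.
Qed.

End occurrences.

Section counting.
Context (R : realType).

(** This is one term of the exponential series: n ^ n / n! <= exp n. *)
Lemma ln_fact_ge n : n%:R * ln n%:R - n%:R <= ln n`!%:R :> R.
Proof.
have [->|n0] := posnP n; first by rewrite fact0 ln1; lra.
have n0' : 0 < n%:R :> R by rewrite ltr0n.
have f0 : 0 < n`!%:R :> R by rewrite ltr0n fact_gt0.
have : n%:R ^+ n / n`!%:R <= expR n%:R :> R.
  rewrite -(prednK n0); apply: le_trans (expR_ge1Dxn n.-1 _) => //.
  by rewrite prednK// lerDr.
rewrite -(ler_ln (x := _ / _)) ?posrE ?expR_gt0 ?divr_gt0 ?exprn_gt0// expRK.
by rewrite ln_div ?posrE ?exprn_gt0// lnXn// -(mulr_natl (ln _) n); lra.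
Qed.

(** By induction, the step being ln (1 + 1 / n) >= 1 / (n + 1). *)
Lemma ln_fact_le n : ln n`!%:R <= n%:R * ln n%:R - n%:R + ln n.+1%:R + 1 :> R.
Proof.
have ln0 m : 0 <= ln m.+1%:R :> R by rewrite ln_ge0// ler1n.
have [->|] := posnP n; first by rewrite fact0 ln1; lra.
case: n => // n _; suff : ln n.+1`!%:R <= n.+1%:R * ln n.+1%:R - n.+1%:R + ln n.+1%:R + 1 :> R.
  move=> h; apply: (le_trans h); rewrite lerD2r lerD2l ler_ln ?posrE ?ltr0n// ler_nat.
  exact: leqnSn.
elim: n => [|n IH]; first by rewrite (_ : 1`! = 1)%N// ln1; lra.
rewrite factS natrM lnM ?posrE ?ltr0n ?fact_gt0//.
apply: (le_trans (lerD (lexx _) IH)).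
have n1 : 0 < n.+1%:R :> R by rewrite ltr0n.
have n2 : 0 < n.+2%:R :> R by rewrite ltr0n.
have n12 : 0 < n.+1%:R / n.+2%:R :> R by rewrite divr_gt0.
have : n.+2%:R * ln (n.+1%:R / n.+2%:R) <= n.+2%:R * (n.+1%:R / n.+2%:R - 1) :> R.
  by rewrite ler_pM2l// ln_le_sub1.
rewrite ln_div ?posrE// mulrBr [leRHS]mulrBr mulrCA divff ?gt_eqF// !mulr1.
have -> : n.+2%:R = n.+1%:R + 1 :> R by rewrite natr1.
by lra.
Qed.

Lemma ln_arrangements (I J : finType) (l : I -> seq nat) (c : I -> J) (s : seq I) :
  (0 < #|J|)%N ->
  (forall i j, c i = c j -> size (l i) = size (l j)) ->
  (forall i j, c i = c j -> l i = l j -> i = j) ->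
  (size s)%:R * ln (size s)%:R - \sum_i ((count_mem i s)%:R * ln (count_mem i s)%:R) <=
  ln (size (arrangements l s))%:R + (size s)%:R * ln #|J|%:R +
    \sum_i (ln (count_mem i s).+1%:R + 1) :> R.
Proof.
move=> J0 cl inj; have h1 := fact_le_permutations s.
have h2 := size_permutations_le s cl inj.
set D := size (arrangements l s) in h2 *.
pose F := (\prod_i (count_mem i s)`!)%N.
have F0 : (0 < F)%N by apply: prodn_gt0 => i; exact: fact_gt0.
have h : ((size s)`! <= D * #|J| ^ size s * F)%N.
  by rewrite (leq_trans h1)// leq_mul2r h2 orbT.
have D0 : (0 < D)%N.
  by case: D h {h2} => //; rewrite mul0n mul0n leqNgt fact_gt0.
have : ln (size s)`!%:R <= ln (D * #|J| ^ size s * F)%:R :> R.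
  by rewrite ler_ln ?posrE ?ltr0n ?fact_gt0 ?muln_gt0 ?D0 ?expn_gt0 ?J0// ler_nat.
rewrite !natrM natrX !lnM ?posrE ?mulr_gt0 ?exprn_gt0 ?ltr0n// lnXn ?ltr0n//.
rewrite -(mulr_natl (ln _) (size s)).
have : ln F%:R <= \sum_i ((count_mem i s)%:R * ln (count_mem i s)%:R - (count_mem i s)%:R +
    (ln (count_mem i s).+1%:R + 1)) :> R.
  pose K (a : nat) (b : R) := (0 < a)%N /\ ln a%:R <= b.
  suff [] : K F (\sum_i ((count_mem i s)%:R * ln (count_mem i s)%:R - (count_mem i s)%:R +
    (ln (count_mem i s).+1%:R + 1))) by [].
  apply: (big_ind2 K) => [|a b a' b' [a0 h3] [a0' h4]|i _]; rewrite /K ?ln1//.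
    by rewrite muln_gt0 a0 a0' natrM lnM ?posrE ?ltr0n// lerD.
  by rewrite fact_gt0; split=> //; rewrite addrA; exact: ln_fact_le.
rewrite big_split/= sumrB -natr_sum sum_count_mem.
have := ln_fact_ge (size s).
by lra.
Qed.

(** The numbers of copies are rounded down from K * p i, which costs terms that
grow more slowly than K: they form the last parenthesis on the left. *)
Lemma ln_arrangements_ge (I J : finType) (l : I -> seq nat) (c : I -> J) (s : seq I)
    (p : I -> R) (K : nat) :
  (0 < #|J|)%N ->
  (forall i j, c i = c j -> size (l i) = size (l j)) ->
  (forall i j, c i = c j -> l i = l j -> i = j) ->
  (0 < K)%N -> (forall i, 0 <= p i <= 1) -> \sum_i p i <= 1 ->
  (forall i, (count_mem i s)%:R <= K%:R * p i <= (count_mem i s)%:R + 1) ->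
  K%:R * (entropy p - (1 - \sum_i p i) - ln #|J|%:R) -
   (#|I|%:R - \sum_i ln (p i) + #|I|%:R * (ln K.+1%:R + 1)) <=
  ln (size (arrangements l s))%:R.
Proof.
move=> J0 cl inj K0 p01 p1 hc.
have K0' : 0 < K%:R :> R by rewrite ltr0n.
have h := ln_arrangements s J0 cl inj.
have J1 : 0 <= ln #|J|%:R :> R by rewrite ln_ge0// ler1n.
have sK : (size s)%:R <= K%:R :> R.
  rewrite -sum_count_mem natr_sum (@le_trans _ _ (\sum_i K%:R * p i))//.
    by apply: ler_sum => i _; have /andP[] := hc i.
  by rewrite -mulr_sumr -[leRHS]mulr1 ler_pM2l.
have h1 : \sum_i (ln (count_mem i s).+1%:R + 1) <= #|I|%:R * (ln K.+1%:R + 1) :> R.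
  rewrite [leRHS]mulr_natl -sumr_const; apply: ler_sum => i _.
  rewrite lerD2r ler_ln ?posrE ?ltr0n// ler_nat ltnS -(ler_nat R).
  have /andP[h2 _] := hc i; apply: (le_trans h2); have /andP[_ pi1] := p01 i.
  by rewrite -[leRHS]mulr1 ler_pM2l.
have h2 : \sum_i ((count_mem i s)%:R * ln (count_mem i s)%:R) <=
    (size s)%:R * ln K%:R + \sum_i (K%:R * p i - 1) * ln (p i) :> R.
  rewrite -sum_count_mem natr_sum mulr_suml -big_split/=; apply: ler_sum => i _.
  have /andP[pi0 pi1] := p01 i; have /andP[c1 c2] := hc i.
  have lp : ln (p i) <= 0 by exact: ln_le0.
  have [n0|n0] := posnP (count_mem i s).
    by rewrite n0 in c2 *; rewrite !mul0r add0r -mulrNN mulr_ge0// oppr_ge0//; lra.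
  have n0' : 0 < (count_mem i s)%:R :> R by rewrite ltr0n.
  have p0 : 0 < p i by rewrite -(pmulr_rgt0 _ K0'); exact: lt_le_trans n0' c1.
  apply: (@le_trans _ _ ((count_mem i s)%:R * (ln K%:R + ln (p i)))).
    by rewrite ler_pM2l// -lnM ?posrE// ler_ln ?posrE ?mulr_gt0.
  rewrite mulrDr lerD2l.
  by rewrite ler_wnM2r//; lra.
have h3 : (size s)%:R * ln K%:R + ((size s)%:R - K%:R) <= (size s)%:R * ln (size s)%:R :> R.
  have [->|n0] := posnP (size s); first by rewrite !mul0r; lra.
  have n0' : 0 < (size s)%:R :> R by rewrite ltr0n.
  have : (size s)%:R * ln (K%:R / (size s)%:R) <= (size s)%:R * (K%:R / (size s)%:R - 1) :> R.
    by rewrite ler_pM2l// ln_le_sub1// divr_gt0.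
  rewrite ln_div ?posrE// mulrBr [leRHS]mulrBr mulrCA divff ?gt_eqF// !mulr1.
  by lra.
have h4 : K%:R * \sum_i p i - #|I|%:R <= (size s)%:R.
  rewrite -sum_count_mem natr_sum mulr_sumr lerBlDr -sum1_card natr_sum -big_split/=.
  by apply: ler_sum => i _; have /andP[] := hc i.
have h5 : (size s)%:R * ln #|J|%:R <= K%:R * ln #|J|%:R :> R by rewrite ler_wpM2r.
move: h2; under [X in _ <= _ + X]eq_bigr do rewrite mulrBl mul1r -mulrA.
rewrite sumrB -mulr_sumr /entropy => h2.
by lra.
Qed.

Definition copies (I : finType) (n : I -> nat) : seq I :=
  flatten [seq nseq (n i) i | i <- enum I].

Lemma count_copies (I : finType) (n : I -> nat) i : count_mem i (copies n) = n i.
Proof.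
rewrite count_flatten -map_comp sumnE big_map big_enum/= (bigD1 i)//= count_nseq/= eqxx mul1n.
by rewrite big1 ?addn0// => j /negPf ji; rewrite count_nseq/= ji.
Qed.

(** After division by K the lower order terms of [ln_arrangements_ge] tend to 0,
and e absorbs them. *)
Lemma many_arrangements (I J : finType) (l : I -> seq nat) (c : I -> J) (p : I -> R) (e : R) :
  (0 < #|J|)%N ->
  (forall i j, c i = c j -> size (l i) = size (l j)) ->
  (forall i j, c i = c j -> l i = l j -> i = j) ->
  (forall i, 0 <= p i <= 1) -> \sum_i p i <= 1 -> 0 < e ->
  exists K0, forall K, (K0 <= K)%N ->
    exists2 s : seq I, (forall i, (count_mem i s)%:R <= K%:R * p i <= (count_mem i s)%:R + 1) &
      K%:R * (entropy p - (1 - \sum_i p i) - ln #|J|%:R - e) <=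
        ln (size (arrangements l s))%:R.
Proof.
move=> J0 cl inj p01 p1 e0.
(* ln (K + 1) <= a (K + 1) - 1 - ln a for every a > 0, so that the lower order
   terms are at most K (e / 2) + C with a as below *)
pose b : R := #|I|%:R + 1.
have b0 : 0 < b by rewrite /b ltr_wpDl// ler0n.
pose a : R := e / 2 / b.
have a0 : 0 < a by rewrite !divr_gt0.
pose C : R := #|I|%:R - \sum_i ln (p i) + b * (a + - ln a).
pose K0 := (Num.truncn (`|C| / (e / 2))).+1.
exists K0 => K KK0; have K1 : (0 < K)%N by apply: leq_trans KK0.
pose n i := Num.truncn (K%:R * p i).
have hn i : (count_mem i (copies n))%:R <= K%:R * p i <= (count_mem i (copies n))%:R + 1.
  rewrite count_copies; have /andP[p0 _] := p01 i.
  have := @truncn_itv R (K%:R * p i); rewrite mulr_ge0 ?ler0n// => /(_ isT)/andP[-> h] /=.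
  by rewrite natr1 ltW.
exists (copies n) => //; apply: le_trans (ln_arrangements_ge J0 cl inj K1 p01 p1 hn).
have hK : 1 < K.+1%:R :> R by rewrite ltr1n.
have lnK : ln K.+1%:R + 1 <= a * K%:R + (a + - ln a).
  have K10 : 0 < K.+1%:R :> R by rewrite ltr0n.
  have : ln (a * K.+1%:R) <= a * K.+1%:R - 1 by apply: ln_le_sub1; rewrite mulr_gt0.
  by rewrite lnM ?posrE// -natr1; lra.
have hC : C <= K%:R * (e / 2).
  rewrite (le_trans (ler_norm _))// -ler_pdivrMr; last by lra.
  have := @truncn_itv R (`|C| / (e / 2)).
  rewrite divr_ge0// => [/(_ isT)/andP[_ h]|]; last by lra.
  by rewrite (le_trans (ltW h))// ler_nat.
have : #|I|%:R * (ln K.+1%:R + 1) <= b * (a * K%:R + (a + - ln a)).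
  apply: ler_pM => //; first by rewrite addr_ge0// ltW// ln_gt0.
  by rewrite /b lerDl.
have : b * a = e / 2 by rewrite /a mulrC divfK// gt_eqF.
rewrite (mulrDr b) mulrA => -> .
by rewrite /C in hC; lra.
Qed.

End counting.

(** * Words weighted by an invariant measure *)

Lemma big_option (R : nmodType) (I : finType) (F : option I -> R) :
  \sum_o F o = F None + \sum_i F (Some i).
Proof.
rewrite (bigD1 None)//=; congr (_ + _).
rewrite (reindex_omap Some id) => [|[i|]]//=.
by apply: eq_bigl => i; rewrite eqxx.
Qed.

Section reading.
Context (A : rel nat) (trA : transitive_matrix A) (I : finType) (k : nat) (W : I -> seq nat).
Hypothesis sizeW : forall i, size (W i) = k.
Hypothesis injW : injective W.

Definition read (x : cms trA) : option I := [pick i | pfx x k == W i].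

Lemma readP x i : read x = Some i <-> cyl (W i) x.
Proof.
rewrite /read /cyl/= sizeW; split.
  by case: pickP => // i' /eqP h [<-].
by move=> e; case: pickP => [i' /eqP|/(_ i)/eqP//]; rewrite e => /injW ->.
Qed.

Lemma fin_measurable_read : fin_measurable read.
Proof.
have mS i : measurable (read @^-1` [set Some i]).
  rewrite (_ : _ @^-1` _ = cyl (W i)); first exact: measurable_cyl.
  by apply/seteqP; split=> x /readP.
case=> // ; rewrite (_ : _ @^-1` _ = ~` (\big[setU/set0]_i (read @^-1` [set Some i]))).
  by apply: measurableC; exact: bigsetU_measurable.
apply/seteqP; split=> x /= h.
  by elim/big_ind: _ => [//|B C nB nC []//|i _ /=]; rewrite h.
by case e: (read x) => [i|//]; case: h; rewrite (bigD1 i)//=; left.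
Qed.

Lemma law_read (R : realType) (nu : probability (cms trA) R) i :
  law nu read (Some i) = pr nu (cyl (W i)).
Proof. by congr pr; apply/seteqP; split=> x /readP. Qed.

End reading.

Section good_words.
Context (A : rel nat) (trA : transitive_matrix A) (R : realType).
Context (mu : probability (cms trA) R).
Hypothesis inv : invariant_measure cms_shift mu.
Implicit Types x y : cms trA.

Lemma pr_decreasing (F : nat -> set (cms trA)) (e : R) : (forall n, measurable (F n)) ->
  (forall m n, (m <= n)%N -> F n `<=` F m) -> (forall x, exists n, ~ F n x) -> 0 < e ->
  exists n, pr mu (F n) <= e.
Proof.
move=> mF dF F0 e0.
have : mu \o F @ \oo --> mu (\bigcap_n F n).
  apply: nonincreasing_cvg_mu => //.
  - by rewrite (le_lt_trans (probability_le1 _ _))// ?ltry.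
  - exact: bigcapT_measurable.
  - by move=> n m nm; apply/subsetPset; exact: dF.
rewrite (_ : \bigcap_n _ = set0); last first.
  by apply/seteqP; split=> x // h; have [n] := F0 x; apply; exact: h.
rewrite measure0 => /fine_cvgP[] _ /cvgrPdist_lt/(_ _ e0)[n _ /(_ n (leqnn n))].
rewrite /= sub0r normrN ger0_norm ?fine_ge0// => /ltW h.
by exists n.
Qed.

Lemma letters_bounded n (e : R) : 0 < e ->
  exists M, pr mu (~` [set x | forall i, (i < n)%N -> (cms_coord x i < M)%N]) <= e.
Proof.
apply: pr_decreasing => [M|M M' MM' x /= h h'|x].
- by apply: measurableC; exact: (@measurable_coords _ trA n (fun _ z => (z < M)%N)).
- by apply: h => i lin; exact: leq_trans (h' i lin) MM'.
- exists (\max_(i < n) cms_coord x i).+1 => /=; apply => i lin.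
  by rewrite ltnS (leq_bigmax (Ordinal lin)).
Qed.

Section words.
Variables (M0 M1 n : nat).

(** A word is its first letter, its middle part of length n and its last letter.
The end letters range over a smaller alphabet, as M0 will be chosen before n and
M1 after it. *)
Definition wordT : finType := ('I_M0 * n.-tuple 'I_M1 * 'I_M0)%type.

Definition word_tail (w : wordT) : seq nat := rcons (map val w.1.2) w.2.
Definition word (w : wordT) : seq nat := val w.1.1 :: word_tail w.

Lemma size_word_tail w : size (word_tail w) = n.+1.
Proof. by rewrite size_rcons size_map size_tuple. Qed.

Lemma size_word w : size (word w) = n.+2.
Proof. by rewrite /= size_word_tail. Qed.

Lemma word_tail_inj w w' : word_tail w = word_tail w' -> w.1.1 = w'.1.1 -> w = w'.
Proof.
case: w w' => [[b t] c] [[b' t'] c'] /rcons_inj[/= e1 e2] e3.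
congr (_, _, _) => //; last exact: val_inj.
by apply/val_inj/(inj_map val_inj).
Qed.

Lemma word_inj : injective word.
Proof. by move=> w w' [/val_inj e1 e2]; exact: word_tail_inj. Qed.

Definition word_of x : option wordT := read n.+2 word x.

Lemma word_ofP x w : word_of x = Some w <-> cyl (word w) x.
Proof. exact: (readP size_word word_inj). Qed.

Lemma fin_measurable_word_of : fin_measurable word_of.
Proof. exact: (fin_measurable_read size_word word_inj). Qed.

Definition wordp (w : wordT) : R := pr mu (cyl (word w)).

Lemma law_word_of w : law mu word_of (Some w) = wordp w.
Proof. exact: (law_read size_word word_inj). Qed.

Lemma sum_wordp : \sum_w wordp w = 1 - law mu word_of None.
Proof.
have := law_sum mu fin_measurable_word_of; rewrite big_option => <-.
by rewrite addrAC subrr add0r; apply: eq_bigr => w _; rewrite law_word_of.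
Qed.

Lemma wordp_gt0 w : 0 < wordp w -> exists x, cyl (word w) x.
Proof.
move=> h; apply: contrapT => nx; move: h; rewrite /wordp /pr.
rewrite (_ : cyl _ = set0) ?measure0 ?ltxx//.
by apply/seteqP; split=> x // wx; case: nx; exists x.
Qed.

(** By invariance the last letter is as rarely large as the first one. *)
Lemma law_word_of_None (e : R) :
  pr mu (~` [set x | forall i, (i < 1)%N -> (cms_coord x i < M0)%N]) <= e ->
  pr mu (~` [set x | forall i, (i < n.+2)%N -> (cms_coord x i < M1)%N]) <= e ->
  law mu word_of None <= 3%:R * e.
Proof.
set B0 := (X in pr mu X <= e -> _) => h0; set B1 := ~` _ => h1.
have mB0 : measurable B0.
  by apply: measurableC; exact: (@measurable_coords _ trA 1 (fun _ z => (z < M0)%N)).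
have mB1 : measurable B1.
  by apply: measurableC; exact: (@measurable_coords _ trA n.+2 (fun _ z => (z < M1)%N)).
have mB0' : measurable [set x | B0 (iter n.+1 cms_shift x)].
  by have := measurable_iter_shift (trA := trA) n.+1 measurableT mB0; rewrite setTI.
have := pr_iter (@measurable_shift _ trA) inv n.+1 mB0 => h2.
apply: (@le_trans _ _ (pr mu (B0 `|` [set x | B0 (iter n.+1 cms_shift x)] `|` B1))).
  apply: le_pr; [exact: fin_measurable_word_of|by apply: measurableU => //; exact: measurableU|].
  move=> x /= xN; apply: contrapT => /not_orP[/not_orP[/contrapT b0 /contrapT b1] /contrapT b2].
  have c0 : (cms_coord x 0 < M0)%N := b0 0%N isT.
  have c1 : (cms_coord x n.+1 < M0)%N.
    by rewrite -[n.+1]addn0 -cms_coord_iter; exact: b1 0%N isT.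
  pose w : wordT := (Ordinal c0, [tuple Ordinal (b2 i.+1 (ltn_trans (ltn_ord i) (ltnSn n))) | i < n], Ordinal c1).
  suff /word_ofP : cyl (word w) x by rewrite xN.
  apply/cylP => -[|i] //; rewrite size_word !ltnS leq_eqVlt => /predU1P[->|lin] /=.
    by rewrite /word_tail nth_rcons size_map size_tuple ltnn eqxx.
  rewrite /word_tail nth_rcons size_map size_tuple lin (nth_map (Ordinal (b2 0%N isT))) ?size_tuple//.
  by rewrite -(tnth_nth _ _ (Ordinal lin)) tnth_mktuple.
rewrite (le_trans (prU _ _ _))//; first exact: measurableU.
have := prU mu mB0 mB0'; rewrite h2; lra.
Qed.

(** The mean number of occurrences of u in a random word is the sum, over the
positions, of the probability to see u there, which is that of the cylinder of u
minus the loss due to the exceptional words.  The first letter of the word is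
left out: in a loop it is the last letter of the path that leads to the word. *)
Lemma occ_wordp u k : (size u <= k)%N -> (k <= n)%N ->
  (n - k)%:R * (pr mu (cyl u) - law mu word_of None) <= \sum_w wordp w * (occ u (word_tail w))%:R.
Proof.
move=> uk kn.
have -> : \sum_w wordp w * (occ u (word_tail w))%:R =
    \sum_(j < n.+1) \sum_w wordp w * (prefix u (drop j (word_tail w)))%:R.
  rewrite exchange_big/=; apply: eq_bigr => w _; rewrite -mulr_sumr; congr (_ * _).
  by rewrite /occ size_word_tail natr_sum.
rewrite (bigID (fun j : 'I_n.+1 => (j < n - k)%N))/= -[leLHS]addr0 lerD//; last first.
  by do 2 apply: sumr_ge0 => ? _; rewrite mulr_ge0// pr_ge0.
rewrite mulr_natl -[X in _ *+ X]card_ord -sumr_const.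
have le_n : (n - k <= n.+1)%N by lia.
rewrite (big_ord_widen_cond _ xpredT (fun=> pr mu (cyl u) - law mu word_of None) le_n)/=.
apply: ler_sum => j jk; pose B : set (cms trA) := [set x | cyl u (iter j.+1 cms_shift x)].
have mB : measurable B.
  by have := measurable_iter_shift (trA := trA) j.+1 measurableT (measurable_cyl (trA := trA) u); rewrite setTI.
rewrite lerBlDr -(pr_iter (@measurable_shift _ trA) inv j.+1 (measurable_cyl u)) -/B.
pose P (o : option wordT) := if o is Some w then prefix u (drop j (word_tail w)) else true.
have -> : \sum_w wordp w * (prefix u (drop j (word_tail w)))%:R + law mu word_of None =
    \sum_(o | P o) law mu word_of o.
  rewrite [RHS]big_mkcond big_option addrC; congr (_ + _); apply: eq_bigr => w _ /=.
  by rewrite law_word_of; case: prefix; rewrite ?mulr1 ?mulr0.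
rewrite -(pr_pred mu P fin_measurable_word_of); apply: le_pr => //.
  by have := measurable_pred P fin_measurable_word_of.
move=> x xB; have /cylP xu : cyl u (iter j.+1 cms_shift x) := xB.
rewrite /=; case e: (word_of x) => [w|]//=.
move/word_ofP/cylP: e; rewrite size_word => xw.
have szu : (size u <= n.+1 - j)%N by lia.
rewrite prefixE; apply/eqP/(@eq_from_nth _ 0%N); rewrite size_takel ?size_drop ?size_word_tail//.
move=> i iu; rewrite nth_take// nth_drop -(xu i iu) cms_coord_iter.
by rewrite addSn xw //= ltnS -ltn_subRL (leq_trans iu szu).
Qed.

(** The names of the exceptional points are among (M + 1) ^ (n + 2) ones, so that
their contribution is small together with their mass; all others are functions
of the word. *)
Lemma entropy_wordp M :
  join_entropy cms_shift mu (alpha M) n.+2 <= entropy wordp +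
    law mu word_of None * (n.+2%:R * ln M.+1%:R) + 1.
Proof.
rewrite join_entropyE; set V := itinerary _ _ _.
have mV : fin_measurable V.
  by apply: fin_measurable_itinerary; [exact: measurable_shift|exact: fin_measurable_alpha].
pose Z x := (word_of x, V x).
have mZ : fin_measurable Z := fin_measurable_pair fin_measurable_word_of mV.
have Z0 z : 0 <= law mu Z z by exact: law_ge0.
apply: (le_trans (@entropy_law_comp _ _ _ mu _ _ Z snd mZ)); rewrite /entropy.
have -> : \sum_z law mu Z z * ln (law mu Z z) =
   \sum_z law mu Z (z.1, z.2) * ln (law mu Z (z.1, z.2)) by apply: eq_bigr => -[].
rewrite -(pair_bigA _ (fun o v => law mu Z (o, v) * ln (law mu Z (o, v))))/= big_option/= opprD.
have ZN : \sum_v law mu Z (None, v) = law mu word_of None.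
  rewrite -[word_of]/(fst \o Z) law_comp// [RHS](reindex (fun v => (None, v)))/=.
    by apply: eq_bigl => v /=; rewrite eqxx.
  by exists snd => [v//|[y' v]] /=; rewrite inE => /eqP <-.
have N1 : law mu word_of None <= 1 by apply: law_le1; exact: fin_measurable_word_of.
have := @entropy_le_card R _ (fun v => law mu Z (None, v)) (fun v => Z0 _).
rewrite ZN => /(_ N1); rewrite card_ffun !card_ord natrX lnXn ?ltr0n// -(mulr_natl (ln _) n.+2).
have : - \sum_w \sum_v law mu Z (Some w, v) * ln (law mu Z (Some w, v)) <=
    - \sum_w wordp w * ln (wordp w).
  rewrite lerN2; apply: ler_sum => w _.
  pose v : {ffun 'I_n.+2 -> 'I_M.+1} := [ffun i : 'I_n.+2 => inord (minn (nth 0%N (word w) i) M)].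
  have Vw x : word_of x = Some w -> V x = v.
    move=> /word_ofP/cylP; rewrite size_word => xw; apply/ffunP => i; rewrite !ffunE.
    by apply: val_inj; rewrite /= alpha_iter inordK ?xw// ltnS geq_minr.
  have -> : wordp w = law mu Z (Some w, v).
    rewrite -law_word_of /law; congr (fine (mu _)); apply/seteqP; split=> x /=.
      by move=> e; rewrite /Z e (Vw _ e).
    by case.
  rewrite (bigD1 v)//= -[leLHS]addr0 lerD2l big1// => v' v'v.
  rewrite (_ : law mu Z (Some w, v') = 0) ?mul0r// /law (_ : _ @^-1` _ = set0) ?measure0//.
  by apply/seteqP; split=> x //= -[/Vw e1 e2]; rewrite -e2 e1 eqxx in v'v.
have : 0 <= law mu word_of None by exact: law_ge0.
by rewrite /entropy; lra.
Qed.

End words.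

End good_words.

(** * The horseshoe *)

Section horseshoe.
Context (A : rel nat) (trA : transitive_matrix A) (R : realType).
Context (mu : probability (cms trA) R).
Hypothesis inv : invariant_measure cms_shift mu.

Lemma join_entropy_ge0 k (P : cms trA -> 'I_k) n : fin_measurable P ->
  0 <= join_entropy cms_shift mu P n.
Proof.
move=> mP; rewrite join_entropyE entropy_ge0// => w; rewrite law_ge0 law_le1//.
by apply: fin_measurable_itinerary => //; exact: measurable_shift.
Qed.

Lemma alpha_entropy_ge (c e : R) : (c%:E <= measure_entropy cms_shift mu)%E -> 0 < e ->
  exists M N0, forall N, (N0 <= N)%N ->
    N%:R * (c - e) <= join_entropy cms_shift mu (alpha M) N.
Proof.
move=> ch e0; have [ce|ce] := leP c e.
  exists 0%N, 0%N => N _; apply: le_trans (join_entropy_ge0 _ (@fin_measurable_alpha _ _ _)).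
  by rewrite mulr_ge0_le0//; lra.
have : ((c - e / 2)%:E < measure_entropy cms_shift mu)%E.
  by apply: lt_le_trans ch; rewrite lte_fin; lra.
move=> /ereal_sup_gt[_ [q [Q [mQ ->]]]]; rewrite lte_fin => hQ.
(* a limit that does not exist is 0 by convention, whereas this one is positive *)
have cQ : cvgn (fun n => join_entropy cms_shift mu Q n / n%:R).
  apply: contrapT => /dvgP h; move: hQ; rewrite /partition_entropy h.
  by rewrite [point](_ : _ = 0)//; lra.
have e4 : 0 < e / 4 by lra.
have [m hm] := join_entropy_le_alpha inv mQ e4.
have [n0 _ hn0] : \forall n \near \oo, c - e / 2 < join_entropy cms_shift mu Q n / n%:R.
  by apply: (cvgr_gt (partition_entropy cms_shift mu Q)).
pose n1 := Num.truncn (4 * m%:R * c / e).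
exists m, (n0 + n1.+1 + m)%N => N hN.
pose n := (N - m)%N; have Nn : N = (n + m)%N by rewrite /n; lia.
have n0' : (0 < n)%N by rewrite /n; lia.
have h1 : 4 * m%:R * c < e * n%:R.
  rewrite [ltRHS]mulrC -ltr_pdivrMr//.
  have q0 : 0 <= 4 * m%:R * c / e.
    by apply: divr_ge0; [apply: mulr_ge0; [exact: mulr_ge0|lra]|lra].
  have /andP[_ h] := truncn_itv q0; apply: (lt_le_trans h); rewrite ler_nat -/n1 /n; lia.
have h2 : n%:R * (c - e / 2) < join_entropy cms_shift mu Q n.
  rewrite [ltLHS]mulrC -ltr_pdivlMr ?ltr0n//; apply: hn0; rewrite /= /n; lia.
have := hm n; rewrite -Nn => h3.
by rewrite Nn natrD; move: h1 h2 h3; rewrite Nn; have : 0 <= m%:R :> R by []; nra.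
Qed.

Lemma loop_flatten a (ss : seq (seq nat)) :
  (forall s, s \in ss -> path A a s /\ last a s = a) ->
  path A a (flatten ss) /\ last a (flatten ss) = a.
Proof.
elim: ss => //= s ss IH h; have [ps ls] := h s (mem_head _ _).
have [pss lss] : path A a (flatten ss) /\ last a (flatten ss) = a.
  by apply: IH => t ht; apply: h; rewrite in_cons ht orbT.
by rewrite cat_path last_cat ps ls.
Qed.

(** The order of the choices matters: the truncation M that sees the entropy, the
admissible loss of mass dl, the bound M0 on the end letters and with it the paths
that close the loops, the length n of the words, the bound M1 on their letters,
and at last the number K of copies. *)
Lemma horseshoe (c e : R) (k T0 : nat) : (c%:E <= measure_entropy cms_shift mu)%E -> 0 < e ->
  exists a T (D : seq (seq nat)),
    [/\ (T0 <= T)%N, uniq D, (0 < size D)%N /\ T%:R * (c - 4 * e) <= ln (size D)%:R :> R,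
        forall d, d \in D -> [/\ size d = T, path A a d & last a d = a] &
        forall d u, d \in D -> (size u <= k)%N ->
          T%:R * (pr mu (cyl u) - 4 * e) <= (occ u d)%:R].
Proof.
move=> ch e0; have [M [N0 hN0]] := alpha_entropy_ge ch e0.
pose L : R := ln M.+1%:R; have L0 : 0 <= L by rewrite ln_ge0// ler1n.
(* dl is at most 1/2, at most e, and at most e divided by the entropy L of a
   truncated letter *)
pose dl := e / (2 * (L + 1 + e)).
have dl_den : 0 < L + 1 + e by lra.
have dl0 : 0 < dl by rewrite divr_gt0//; lra.
have dlE : dl * (2 * (L + 1 + e)) = e by rewrite /dl divfK// gt_eqF//; lra.
have dl3 : 0 < dl / 3 by lra.
have dl_half : dl <= 1 / 2 by rewrite /dl ler_pdivrMr; lra.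
have dl_e : dl <= e by rewrite /dl ler_pdivrMr; [rewrite -[leLHS]mulr1 ler_pM2l//; lra|lra].
have dlL : dl * L <= e by rewrite -[leRHS]dlE ler_pM2l//; lra.
have [M0' hM0'] := letters_bounded mu 1 dl3.
pose M0 := M0'.+1.
have hM0 : pr mu (~` [set x | forall i, (i < 1)%N -> (cms_coord x i < M0)%N]) <= dl / 3.
  apply: le_trans hM0'; apply: le_pr; [| |move=> x /= h h'; apply: h => i i1].
  - by apply: measurableC; exact: (@measurable_coords _ trA 1 (fun _ z => (z < M0)%N)).
  - by apply: measurableC; exact: (@measurable_coords _ trA 1 (fun _ z => (z < M0')%N)).
  - by rewrite /M0 ltnS ltnW// h'.
have /choice[r hr] : forall b, exists w, path A 0%N w /\ last 0%N w = b.
  by move=> b; have [w] := trA 0%N b; exists w.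
have /choice[s hs] : forall b, exists w, path A b w /\ last b w = 0%N.
  by move=> b; have [w] := trA b 0%N; exists w.
pose S := (\sum_(b < M0) (size (r b) + size (s b)))%N.
have rS (b : 'I_M0) : (size (r b) <= S)%N.
  by rewrite /S (bigD1 b)//= -addnA leq_addr.
have sS (b : 'I_M0) : (size (s b) <= S)%N.
  by rewrite /S (bigD1 b)//= -addnA addnCA leq_addr.
pose J : finType := ('I_M0 * 'I_M0)%type.
have J0 : (0 < #|J|)%N by rewrite card_prod card_ord muln_gt0.
pose lJ : R := ln #|J|%:R; have lJ0 : 0 <= lJ by rewrite ln_ge0// ler1n.
(* e * n has to exceed all the terms that do not depend on n *)
pose q : R := (3 + lJ + 2 * S%:R * `|c| + k%:R + 2 * S%:R) / e.
have [n [nN0 kn hq]] : exists n, [/\ (N0 <= n)%N, (k <= n)%N &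
    3 + lJ + 2 * S%:R * `|c| + k%:R + 2 * S%:R <= e * n%:R].
  exists (N0 + k + (Num.truncn q).+1)%N; split; rewrite -?addnA ?leq_addr//.
    by rewrite addnCA leq_addr.
  rewrite [leRHS]mulrC -ler_pdivrMr// -/q.
  have q0 : 0 <= q.
    apply: divr_ge0; last exact: ltW.
    have : 0 <= S%:R * `|c| by exact: mulr_ge0.
    have : 0 <= k%:R :> R by []. have : 0 <= S%:R :> R by [].
    lra.
  have /andP[_ /ltW h] := truncn_itv q0; apply: (le_trans h).
  by rewrite ler_nat addnA leq_addl.
have [M1 hM1] := letters_bounded mu n.+2 dl3.
pose I := wordT M0 M1 n.
(* consecutive loops share the base letter: l w omits it at its start and has it
   at its end *)
pose l (w : I) := r w.1.1 ++ map val w.1.2 ++ (val w.2 :: s w.2).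
have lE w : l w = r w.1.1 ++ word_tail w ++ s w.2 by rewrite /l /word_tail cat_rcons.
pose cc (w : I) : J := (w.1.1, w.2).
have cl w w' : cc w = cc w' -> size (l w) = size (l w').
  by move=> [e1 e2]; rewrite !lE !size_cat !size_word_tail e1 e2.
have inj w w' : cc w = cc w' -> l w = l w' -> w = w'.
  move=> [e1 e2]; rewrite !lE e1 e2 => /eqP; rewrite eqseq_cat// eqxx/= eqseq_cat ?size_word_tail//.
  by move=> /andP[/eqP h _]; exact: word_tail_inj h e1.
pose p := wordp mu (M0 := M0) (M1 := M1) (n := n).
have p01 w : 0 <= p w <= 1.
  by rewrite pr_ge0 pr_le1//; exact: measurable_cyl.
have pS : \sum_w p w = 1 - law mu (@word_of _ trA M0 M1 n) None by exact: sum_wordp.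
have sN : law mu (@word_of _ trA M0 M1 n) None <= dl.
  by have := law_word_of_None inv hM0 hM1; lra.
set sg := law mu _ None in pS sN.
have sg0 : 0 <= sg by exact: law_ge0.
have p1 : \sum_w p w <= 1 by rewrite pS; lra.
have := @many_arrangements R I J l cc p 1 J0 cl inj p01 p1 ltr01.
move=> [K0 hK0].
have [nI nIE] : exists nI, nI = #|{: I}| by exists #|{: I}|.
have [K [KK0 KI KT Kpos]] : exists K, [/\ (K0 <= K)%N, (nI * n.+1 <= K)%N,
    (2 * (nI + T0) <= K)%N & (0 < K)%N].
  by exists (K0 + nI * n.+1 + 2 * (nI + T0) + 1)%N; clear; split; lia.
have [t ht hD] := hK0 K KK0.
pose D := arrangements l t; exists 0%N, (size (flatten (map l t))), D.
have DP d : d \in D -> exists2 t', perm_eq t' t & d = flatten (map l t').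
  by rewrite mem_undup => /mapP[t']; rewrite mem_permutations => h ->; exists t'.
have Dsize d : d \in D -> size d = size (flatten (map l t)).
  move=> /DP[t' pt ->]; rewrite !size_flatten /shape -!map_comp !sumnE !big_map.
  exact: perm_big.
have D0 : (0 < size D)%N.
  rewrite lt0n; apply/eqP => /size0nil D0.
  suff : flatten (map l t) \in D by rewrite D0.
  rewrite mem_undup; apply/mapP; exists t => //; by rewrite mem_permutations.
have K1 : 0 < K%:R :> R by rewrite ltr0n.
have Tle : (size (flatten (map l t)))%:R <= K%:R * (n.+1%:R + 2 * S%:R) :> R.
  rewrite size_flatten /shape -map_comp sumnE big_map sum_map_count natr_sum.
  apply: (@le_trans _ _ (\sum_i (K%:R * p i) * (n.+1%:R + 2 * S%:R))).
    apply: ler_sum => i _; rewrite natrM; have /andP[h1 _] := ht i; apply: ler_pM => //.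
    rewrite -[(size \o l) i]/(size (l i)) lE !size_cat size_word_tail -natrM -natrD ler_nat.
    have := rS i.1.1; have := sS i.2; clear; lia.
  rewrite -mulr_suml -mulr_sumr ler_wpM2r ?addr_ge0 ?mulr_ge0//.
  by rewrite -[leRHS]mulr1 ler_pM2l.
have tI (w : I) : w \in t -> path A 0%N (l w) /\ last 0%N (l w) = 0%N.
  move=> wt; have [x xw] : exists x, @cyl _ trA (word w) x.
    apply: (@wordp_gt0 _ _ _ mu); rewrite -/(p w).
    have /andP[h _] := ht w; have : 0 < K%:R * p w.
      by apply: lt_le_trans h; rewrite ltr0n -has_count has_pred1.
    by rewrite pmulr_rgt0.
  have pw : path A (val w.1.1) (word_tail w).
    apply/(pathP 0%N) => i; rewrite size_word_tail => lin.
    move/cylP: xw; rewrite size_word => xw.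
    rewrite -[nth 0%N (_ :: _) i]xw; last exact: ltnW.
    rewrite -[nth 0%N (word_tail w) i]/(nth 0%N (word w) i.+1) -xw//.
    exact: (set_valP x i).
  rewrite lE !cat_path !last_cat (hr _).1 (hr _).2 pw/=.
  by rewrite [last _ (word_tail w)]last_rcons; split; [exact: (hs _).1|exact: (hs _).2].
split=> //.
- have : T0%:R <= (size (flatten (map l t)))%:R :> R; last by rewrite ler_nat.
  rewrite size_flatten /shape -map_comp sumnE big_map sum_map_count natr_sum.
  apply: (@le_trans _ _ (\sum_i (K%:R * p i - 1))); last first.
    apply: ler_sum => i _; rewrite natrM; have /andP[_ h] := ht i.
    apply: (@le_trans _ _ ((count_mem i t)%:R * 1)); first by lra.
    by rewrite ler_wpM2l// ler1n -[(size \o l) i]/(size (l i)) lE !size_cat size_word_tail addSn addnS.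
  rewrite sumrB -mulr_sumr pS sumr_const -nIE.
  have : nI%:R + T0%:R <= K%:R / 2 :> R.
    by rewrite ler_pdivlMr// -natrD -natrM ler_nat mulnC.
  have : K%:R * sg <= K%:R * (1 / 2) by rewrite ler_wpM2l//; lra.
  by lra.
- exact: undup_uniq.
- split=> //; have lnD : 0 <= ln (size D)%:R :> R by rewrite ln_ge0// ler1n.
  have [ce|ce] := leP (c - 4 * e) 0.
    by apply: le_trans lnD; rewrite mulr_ge0_le0.
  apply: (le_trans _ hD); apply: (@le_trans _ _ (K%:R * (n.+1%:R + 2 * S%:R) * (c - 4 * e))).
    by rewrite ler_pM2r.
  rewrite -mulrA ler_pM2l// pS.
  have hp := entropy_wordp mu M0 M1 n M.
  rewrite -/sg -/p -/L in hp.
  have hN : n.+2%:R * (c - e) <= join_entropy cms_shift mu (alpha M) n.+2.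
    by apply: hN0; rewrite (leq_trans nN0)// leqW.
  have hsg : sg * (n.+2%:R * L) <= e * n.+2%:R.
    by rewrite mulrCA [leRHS]mulrC ler_wpM2l// (le_trans _ dlL)// ler_wpM2r.
  have cc' : `|c| = c by rewrite ger0_norm//; lra.
  rewrite cc' in hq.
  have : S%:R * (c - 4 * e) <= S%:R * c by rewrite ler_wpM2l//; lra.
  have e2 : n.+2%:R = n%:R + 2 :> R by rewrite -addn2 natrD.
  have e1 : n.+1%:R = n%:R + 1 :> R by rewrite -addn1 natrD.
  rewrite e2 in hN hsg hp; rewrite e1 -/lJ.
  have : 0 <= S%:R :> R by []. have : 0 <= k%:R :> R by [].
  have : 0 <= S%:R * c by apply: mulr_ge0 => //; lra.
  by lra.
- by move=> d dD; have [h1 h2] : path A 0%N d /\ last 0%N d = 0%N; [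
   have [t' pt ->] := DP _ dD; apply: loop_flatten => _ /mapP[w wt ->]; apply: tI; rewrite -(perm_mem pt)
   |rewrite Dsize].
- move=> d u dD uk.
  set m := pr mu (cyl u); have [me|me] := leP (m - 4 * e) 0.
    by apply: (le_trans _ (ler0n _ _)); rewrite mulr_ge0_le0.
  have [t' pt ->] := DP _ dD.
  apply: (@le_trans _ _ (\sum_i (K%:R * p i - 1) * (occ u (word_tail i))%:R)); last first.
    apply: (@le_trans _ _ (\sum_(w <- t) occ u (l w))%N%:R); last first.
      by rewrite -(perm_big _ pt)/= ler_nat -(big_map l xpredT (occ u)) occ_flatten.
    rewrite sum_map_count natr_sum; apply: ler_sum => w _; rewrite natrM.
    apply: (@le_trans _ _ ((count_mem w t)%:R * (occ u (word_tail w))%:R)).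
      by rewrite ler_wpM2r//; have /andP[_ h] := ht w; lra.
    rewrite ler_wpM2l// ler_nat lE.
    have := occ_cat u (r w.1.1) (word_tail w ++ s w.2).
    have := occ_cat u (word_tail w) (s w.2). clear; lia.
  apply: (@le_trans _ _ (K%:R * (n.+1%:R + 2 * S%:R) * (m - 4 * e))).
    by rewrite ler_pM2r.
  have := occ_wordp inv M0 M1 uk kn; rewrite -/sg -/m => hocc.
  have occ_n (w : I) : (occ u (word_tail w))%:R <= n.+1%:R :> R.
    by rewrite ler_nat; have := occ_le_size u (word_tail w); rewrite size_word_tail.
  have h1 : \sum_i (K%:R * p i - 1) * (occ u (word_tail i))%:R >=
      K%:R * ((n - k)%:R * (m - sg)) - nI%:R * n.+1%:R.
    under eq_bigr do rewrite mulrBl mul1r -mulrA.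
    rewrite sumrB -mulr_sumr lerB ?ler_pM2l// nIE [leRHS]mulr_natl -sumr_const.
    by apply: ler_sum => w _; exact: occ_n.
  apply: le_trans h1.
  have hK1 : nI%:R * n.+1%:R <= K%:R :> R.
    by rewrite -natrM ler_nat.
  have m1 : m <= 1 by apply: pr_le1; exact: measurable_cyl.
  have e1 : n.+1%:R = n%:R + 1 :> R by rewrite -addn1 natrD.
  have hS : (1 + 2 * S%:R) * (m - 4 * e) <= 1 + 2 * S%:R.
    by rewrite -[leRHS]mulr1 ler_wpM2l ?addr_ge0 ?mulr_ge0//; lra.
  have hk : k%:R * (m - e) <= k%:R :> R by rewrite -[leRHS]mulr1 ler_wpM2l//; lra.
  have hn : (n - k)%:R * (m - e) <= (n - k)%:R * (m - sg) by rewrite ler_wpM2l//; lra.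
  have hSc : 0 <= S%:R * `|c| by exact: mulr_ge0.
  apply: (@le_trans _ _ (K%:R * ((n - k)%:R * (m - sg) - 1))); last first.
    by rewrite mulrBr mulr1 lerD2l lerN2.
  rewrite -mulrA ler_pM2l//.
  rewrite natrB// in hn *; rewrite e1.
  have : 0 <= S%:R :> R by []. have : 0 <= k%:R :> R by [].
  by lra.
Qed.

End horseshoe.

(** * Digits of a uniform random number *)

Section digits.
Context (R : realType).
Notation Rm := (measurableTypeR R).

Definition unif : set Rm -> \bar R :=
  mrestr (@lebesgue_measure R) (measurable_itv `[0%R, 1%R[).

HB.instance Definition _ := Measure.on unif.

Lemma unif_setT : unif setT = 1%:E.
Proof.
by rewrite /unif /mrestr setTI lebesgue_measure_itv/= lte_fin ltr01 sube0.
Qed.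

HB.instance Definition _ := Measure_isProbability.Build _ _ R unif unif_setT.

Variable k : nat.

(** The truncation by k only matters outside of [0, 1[. *)
Definition digit (x : Rm) : 'I_k.+1 := inord (minn (Num.truncn (k.+1%:R * x)) k).
Definition stretch (x : Rm) : Rm := k.+1%:R * x - (digit x)%:R.

Lemma digit_val x : digit x = minn (Num.truncn (k.+1%:R * x)) k :> nat.
Proof. by rewrite /digit inordK// ltnS geq_minr. Qed.

Lemma measurable_trunc m : measurable [set x : Rm | (m <= Num.truncn (k.+1%:R * x))%N].
Proof.
case: m => [|m].
  by rewrite (_ : [set x | _] = setT)//; apply/seteqP; split.
rewrite (_ : [set x | _] = `[m.+1%:R / k.+1%:R, +oo[%classic) ?measurable_itv//.
apply/seteqP; split=> x /=; rewrite in_itv/= andbT truncn_gt_nat ler_pdivrMr ?ltr0n// mulrC//.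
Qed.

Lemma fin_measurable_digit : fin_measurable digit.
Proof.
move=> d; have le_d m : measurable [set x | (m <= digit x)%N].
  have [mk|mk] := leqP m k.
    rewrite (_ : [set x | _] = [set x : Rm | (m <= Num.truncn (k.+1%:R * x))%N]).
      exact: measurable_trunc.
    by apply/seteqP; split=> x /=; rewrite digit_val leq_min mk andbT.
  rewrite (_ : [set x | _] = set0)//; apply/seteqP; split=> x //= h.
  by have := leq_trans mk h; rewrite leqNgt ltn_ord.
rewrite (_ : _ @^-1` _ = [set x | (d <= digit x)%N] `\` [set x | (d.+1 <= digit x)%N]).
  exact: measurableD.
apply/seteqP; split=> x /= => [->|[h /negP]]; first by rewrite leqnn ltnn.
by rewrite -leqNgt => h'; apply/val_inj/anti_leq; rewrite h h'.
Qed.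

Lemma measurable_stretch : measurable_fun setT stretch.
Proof.
move=> _ B mB; rewrite setTI (_ : _ @^-1` _ = \big[setU/set0]_(d : 'I_k.+1)
    (digit @^-1` [set d] `&` (fun x : Rm => k.+1%:R * x - d%:R : Rm) @^-1` B)).
  apply: bigsetU_measurable => d _; apply: measurableI; first exact: fin_measurable_digit.
  have mf : measurable_fun setT (fun x : Rm => k.+1%:R * x - d%:R : Rm).
    by apply: measurable_funB => //; exact: measurable_funM.
  by have := mf measurableT _ mB; rewrite setTI.
apply/seteqP; split=> x /=.
  by move=> Bx; rewrite (bigD1 (digit x))//=; left.
elim/big_ind: _ => //= [B1 B2 h1 h2 []//|d _ [dx]].
by rewrite /stretch/= dx.
Qed.

HB.instance Definition _ := isMeasurableFun.Build _ _ _ _ stretch measurable_stretch.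

Lemma digit_itv (d : 'I_k.+1) :
  digit @^-1` [set d] `&` `[0, 1[ = `[d%:R / k.+1%:R, d.+1%:R / k.+1%:R[%classic.
Proof.
have k0 : 0 < k.+1%:R :> R by rewrite ltr0n.
apply/seteqP; split=> x /=; rewrite !in_itv/= ler_pdivrMr// ltr_pdivlMr// ![x * _]mulrC.
  move=> [dx /andP[x0 x1]].
  have kx0 : 0 <= k.+1%:R * x by rewrite mulr_ge0.
  have kx1 : k.+1%:R * x < k.+1%:R by rewrite -[ltRHS]mulr1 ltr_pM2l.
  have le_k : (Num.truncn (k.+1%:R * x) <= k)%N by rewrite truncn_le_nat.
  have <- : Num.truncn (k.+1%:R * x) = d by rewrite -dx digit_val (minn_idPl le_k).
  exact: truncn_itv.
move=> h; have e : Num.truncn (k.+1%:R * x) = d by exact: truncn_def.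
split; first by apply: val_inj; rewrite /= digit_val e; apply/minn_idPl; rewrite -ltnS.
have /andP[h1 h2] := h.
rewrite -(pmulr_rge0 _ k0) (le_trans _ h1)//= -(ltr_pM2l k0) mulr1 (lt_le_trans h2)//.
by rewrite ler_nat.
Qed.

(** The stretching maps each interval of constant digit affinely onto [0, 1[;
half-lines suffice to identify the two measures. *)
Lemma unif_digit (d : 'I_k.+1) (B : set Rm) : measurable B ->
  unif (stretch @^-1` B `&` digit @^-1` [set d]) = ((k.+1%:R^-1)%:E * unif B)%E.
Proof.
move=> mB; have k0 : 0 < k.+1%:R :> R by rewrite ltr0n.
have k0' : 0 <= k.+1%:R^-1 :> R by rewrite invr_ge0.
pose m1_ : {measure set Rm -> \bar R} := pushforward (mrestr unif (fin_measurable_digit d)) stretch.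
pose m1 := m1_ measurable_stretch.
pose m2 : {measure set Rm -> \bar R} := mscale (NngNum k0') unif.
suff : m1 B = m2 B by [].
apply: (@measure_unique _ R Rm (@RGenCInfty.G R) (fun n => `[- n%:R, +oo[%classic)
  _ _ _ _ m1 m2 _ _ B mB).
- exact: RGenCInfty.measurableE.
- move=> _ _ [x ->] [y ->]; exists (Num.max x y).
  by apply/seteqP; split=> z /=; rewrite !in_itv/= !andbT ge_max; [by move=> [-> ->]|by move=> /andP[]].
- by move=> i; exists (- i%:R).
- apply/seteqP; split=> x // _; exists (Num.truncn `|x|).+1 => //=; rewrite in_itv/= andbT.
  by rewrite lerNl (le_trans (ler_norm _))// normrN ltW// truncnS_gt.
- move=> _ [x ->]; rewrite /m1 /m2 /mscale/= /pushforward /mrestr /unif /mrestr.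
  rewrite -setIA digit_itv.
  rewrite (_ : _ `&` _ = `[(d%:R + Num.max 0 x) / k.+1%:R, d.+1%:R / k.+1%:R[%classic).
    have e : d.+1%:R / k.+1%:R - (d%:R + Num.max 0 x) / k.+1%:R = k.+1%:R^-1 * (1 - Num.max 0 x).
      by rewrite -mulrBl mulrC -natr1; congr (_ * _); lra.
    rewrite [RHS](_ : _ = ((k.+1%:R^-1)%:E * lebesgue_measure (`[x, +oo[ `&` `[0%R, 1%R[))%E)//.
    rewrite (_ : _ `&` _ = `[Num.max 0 x, 1%R[%classic); last first.
      apply/seteqP; split=> z /=; rewrite !in_itv/= ge_max andbT.
        by move=> [-> /andP[-> ->]].
      by move=> /andP[/andP[-> ->] ->].
    rewrite !lebesgue_measure_itv/= !lte_fin ltr_pM2r ?invr_gt0// -natr1 ltrD2l.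
    case: ltP => _; last by rewrite mule0.
    by rewrite -EFinB natr1 e EFinM EFinB.
  have dz (z : R) : `[d%:R / k.+1%:R, d.+1%:R / k.+1%:R[%classic z -> digit z = d.
    by rewrite -digit_itv => -[].
  apply/seteqP; split=> z /=.
    move=> [xz hz]; move: xz; rewrite /= !in_itv/= andbT /stretch (dz _ hz).
    move: hz; rewrite /= in_itv/= => /andP[h1 ->]; rewrite andbT => h2.
    rewrite ler_pdivrMr// [z * _]mulrC; move: h1; rewrite ler_pdivrMr// [z * _]mulrC => h1.
    rewrite -lerBrDl ge_max subr_ge0 h1. exact: h2.
  rewrite in_itv/= => /andP[h1 h2].
  have hz : `[d%:R / k.+1%:R, d.+1%:R / k.+1%:R[%classic z.
    rewrite /= in_itv/= h2 andbT (le_trans _ h1)// ler_pM2r ?invr_gt0// lerDl.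
    by rewrite le_max lexx.
  split=> //; rewrite /= in_itv/= andbT /stretch (dz _ hz).
  move: h1; rewrite ler_pdivrMr// [z * _]mulrC -lerBrDl ge_max => /andP[_].
  exact.
- move=> n; rewrite (@le_lt_trans _ _ 1%E)// ?ltry// /m1 /= /pushforward /mrestr.
  by apply: probability_le1; apply: measurableI; [
    have := measurable_stretch measurableT (measurable_itv `[- n%:R, +oo[); rewrite setTI
    |exact: fin_measurable_digit].
Qed.

Lemma pr_digit (d : 'I_k.+1) (B : set Rm) : measurable B ->
  pr unif [set x | digit x = d /\ B (stretch x)] = k.+1%:R^-1 * pr unif B.
Proof.
move=> mB; rewrite (_ : [set x | _] = stretch @^-1` B `&` digit @^-1` [set d]).
  by rewrite [LHS](congr1 fine (unif_digit d mB)) (prE unif mB) -EFinM.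
by apply/seteqP; split=> x [].
Qed.

Lemma measurable_preimage_stretch n B : measurable B -> measurable [set x | B (iter n stretch x)].
Proof. by move=> mB; have := measurable_iter measurable_stretch n measurableT mB; rewrite setTI. Qed.

(** Independence of the first q digits among themselves and from what comes after
them, by q applications of [unif_digit]. *)
Lemma pr_digits q (w : nat -> 'I_k.+1) B : measurable B ->
  pr unif [set x | (forall i, (i < q)%N -> digit (iter i stretch x) = w i) /\ B (iter q stretch x)] =
   k.+1%:R^-1 ^+ q * pr unif B.
Proof.
move=> mB; elim: q w => [|q IH] w.
  by rewrite expr0 mul1r; congr pr; apply/seteqP; split=> x /=; [case|move=> Bx; split].
pose C : set Rm := [set x | (forall i, (i < q)%N -> digit (iter i stretch x) = w i.+1) /\ B (iter q stretch x)].
have mC : measurable C.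
  rewrite (_ : C = \bigcap_i (if (i < q)%N then (digit \o iter i stretch) @^-1` [set w i.+1] else setT)
     `&` [set x | B (iter q stretch x)]).
    apply: measurableI; last exact: measurable_preimage_stretch.
    apply: bigcapT_measurable => i; case: ifP => // _.
    by apply: fin_measurable_iter; [exact: measurable_stretch|exact: fin_measurable_digit].
  apply/seteqP; split=> x [h1 h2]; split=> //.
    by move=> i _; case: ifP => //= iq; exact: h1.
  by move=> i iq; have := h1 i Logic.I; rewrite iq.
have := pr_digit (w 0%N) mC; rewrite /C IH exprS -mulrA => <-; congr pr.
apply/seteqP; split=> x /=; rewrite -iterS iterSr.
  move=> [h1 h2]; split; first exact: h1 0%N isT.
  by split=> // i iq; rewrite -iterSr; exact: h1 i.+1 iq.
move=> [h0 [h1 h2]]; split=> // -[|i] // iq; rewrite iterSr; exact: h1.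
Qed.

Lemma pr_stretch (B : set Rm) : measurable B -> pr unif [set x | B (stretch x)] = pr unif B.
Proof.
move=> mB; rewrite (pr_partition unif fin_measurable_digit (measurable_preimage_stretch 1 mB)).
under eq_bigr do rewrite pr_digit//.
by rewrite sumr_const card_ord -[LHS]mulr_natl mulrA divff ?mul1r// pnatr_eq0.
Qed.

End digits.

(** * The measure of random concatenations *)

Section concatenation.
Context (A : rel nat) (trA : transitive_matrix A) (R : realType).
Variables (k t a : nat) (w : 'I_k.+1 -> seq nat).
Let T := t.+1.
Hypothesis wT : forall d, size (w d) = T.
Hypothesis wp : forall d, path A a (w d).
Hypothesis wl : forall d, last a (w d) = a.
Notation Rm := (measurableTypeR R).
Notation D := (@digit R k).
Notation E := (@stretch R k).

Definition concat_seq (y : Rm) (i : nat) : nat := nth 0%N (w (D (iter (i %/ T) E y))) (i %% T).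

Lemma concat_admissible y : admissible_sequences A (concat_seq y).
Proof.
move=> i; rewrite /concat_seq.
have lt_i : (i %% T < T)%N by rewrite ltn_mod.
set d := D _; have /pathP pd := wp d.
have [lt1|ge1] := ltnP (i %% T).+1 T.
  have e : (i.+1 %/ T = i %/ T)%N.
    by rewrite {1}(divn_eq i T) -addnS divnMDl// (divn_small lt1) addn0.
  have e' : (i.+1 %% T = (i %% T).+1)%N.
    by rewrite {1}(divn_eq i T) -addnS modnMDl (modn_small lt1).
  by rewrite e e' -/d; have := pd 0%N (i %% T).+1; rewrite wT => /(_ lt1).
have eT : (i %% T).+1 = T by apply: anti_leq; rewrite ge1 lt_i.
have ei : i.+1 = ((i %/ T).+1 * T)%N by rewrite {1}(divn_eq i T) -addnS eT mulSn addnC.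
rewrite ei mulnK// modnMl.
set d' := D _; have := wp d'; have := wT d'; case: (w d') => [//|b s] _ /= /andP[+ _].
congr A; have -> : (i %% T)%N = t by case: eT.
by rewrite -(wl d) (last_nth 0%N) wT.
Qed.

Definition concat (y : Rm) : cms trA := SigSub (mem_set (concat_admissible y)).

Lemma concat_coord y i : cms_coord (concat y) i = concat_seq y i.
Proof. by []. Qed.

Lemma concat_stretch y : iter T cms_shift (concat y) = concat (E y).
Proof.
apply: cms_coord_inj => i; rewrite cms_coord_iter !concat_coord /concat_seq.
by rewrite modnDl -[(T + i)%N]/(T + i)%N -{1}[T]mul1n divnMDl// add1n iterSr.
Qed.

Lemma concat_eq n y z : (forall i, (i < n)%N -> D (iter i E y) = D (iter i E z)) ->
  forall i, (i < n * T)%N -> cms_coord (concat y) i = cms_coord (concat z) i.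
Proof.
move=> h i lin; rewrite !concat_coord /concat_seq h//.
by rewrite ltn_divLR.
Qed.

Lemma measurable_concat : measurable_fun setT concat.
Proof.
apply: measurable_fun_cms => u.
rewrite (_ : _ @^-1` _ = \bigcap_i (if (i < size u)%N then
    [set y | nth 0%N (w ((D \o iter (i %/ T) E) y)) (i %% T) == nth 0%N u i] else setT)).
  apply: bigcapT_measurable => i; case: ifP => // _.
  have mD : fin_measurable (D \o iter (i %/ T) E).
    by apply: fin_measurable_iter; [exact: measurable_stretch|exact: fin_measurable_digit].
  by have := measurable_pred (fun d => nth 0%N (w d) (i %% T) == nth 0%N u i) mD.
apply/seteqP; split=> y /=.
  by move=> /cylP h i _; case: ifP => // /h /= <-; rewrite concat_coord.
move=> h; apply/cylP => i lti; have := h i Logic.I; rewrite lti /= => /eqP <-.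
by rewrite concat_coord.
Qed.

HB.instance Definition _ := isMeasurableFun.Build _ _ _ _ concat measurable_concat.

Notation Dt := (@digit R t).
Notation Et := (@stretch R t).

(** The first digit of x in base T is the phase, and the rest of x drives the
concatenation: one uniform number provides both. *)
Definition stationary_map (x : Rm) : cms trA := iter (Dt x) cms_shift (concat (Et x)).

Lemma measurable_stationary_map : measurable_fun setT stationary_map.
Proof.
move=> _ B mB; rewrite setTI (_ : _ @^-1` _ = \big[setU/set0]_(d : 'I_t.+1)
    (Dt @^-1` [set d] `&` (fun x => iter d cms_shift (concat (Et x))) @^-1` B)).
  apply: bigsetU_measurable => d _; apply: measurableI; first exact: fin_measurable_digit.
  have mf : measurable_fun setT (fun x => iter d cms_shift (concat (Et x))).
    apply: (measurableT_comp (measurable_iter_shift d)).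
    exact: (measurableT_comp measurable_concat (@measurable_stretch R t)).
  by have := mf measurableT _ mB; rewrite setTI.
apply/seteqP; split=> x /=.
  by move=> Bx; rewrite (bigD1 (Dt x))//=; left.
elim/big_ind: _ => //= [B1 B2 h1 h2 []//|d _ [dx]].
by rewrite /stationary_map dx.
Qed.

HB.instance Definition _ := isMeasurableFun.Build _ _ _ _ stationary_map measurable_stationary_map.

Definition concat_measure : probability (cms trA) R := distribution (@unif R) stationary_map.

Lemma pr_concat_measureE B : pr concat_measure B = pr (@unif R) (stationary_map @^-1` B).
Proof. by []. Qed.

Lemma measurable_concat_iter j B : measurable B -> measurable [set y | B (iter j cms_shift (concat y))].
Proof.
move=> mB; have mf : measurable_fun setT (fun y => iter j cms_shift (concat y)).
  exact: (measurableT_comp (measurable_iter_shift j) measurable_concat).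
by have := mf measurableT _ mB; rewrite setTI.
Qed.

Lemma pr_concat_measure B : measurable B ->
  pr concat_measure B = T%:R^-1 * \sum_(j < T) pr (@unif R) [set y | B (iter j cms_shift (concat y))].
Proof.
move=> mB; rewrite pr_concat_measureE.
have mP : measurable (stationary_map @^-1` B).
  by have := measurable_stationary_map measurableT mB; rewrite setTI.
rewrite (pr_partition (@unif R) (@fin_measurable_digit R t) mP) mulr_sumr; apply: eq_bigr => j _.
rewrite -(pr_digit j (measurable_concat_iter j mB)); congr pr.
by apply/seteqP; split=> x /= [e]; rewrite /stationary_map e.
Qed.

(** The T phases are permuted cyclically by the shift, since T shifts amount to
dropping one loop. *)
Lemma concat_measure_invariant : invariant_measure cms_shift concat_measure.
Proof.
move=> B mB.
have mB' : measurable (@cms_shift A trA @^-1` B).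
  by have := @measurable_shift A trA measurableT _ mB; rewrite setTI.
rewrite (prE concat_measure mB') (prE concat_measure mB); congr EFin.
rewrite !pr_concat_measure//; congr (_ * _).
rewrite /T big_ord_recr [RHS]big_ord_recl/= addrC; congr (_ + _).
rewrite -(pr_stretch k (measurable_concat_iter 0 mB)); congr pr.
by apply/seteqP; split=> y /=; rewrite -concat_stretch.
Qed.

Definition digits q (y : Rm) : {ffun 'I_q -> 'I_k.+1} := [ffun i : 'I_q => D (iter i E y)].

Lemma fin_measurable_digits q : fin_measurable (digits q).
Proof.
by apply: (fin_measurable_itinerary (@measurable_stretch R k)); exact: fin_measurable_digit.
Qed.

Lemma pr_digitsP q (v : {ffun 'I_q -> 'I_k.+1}) B : measurable B ->
  pr (@unif R) [set y | digits q y = v /\ B (iter q E y)] = k.+1%:R^-1 ^+ q * pr (@unif R) B.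
Proof.
move=> mB; pose v' i : 'I_k.+1 := if insub i is Some j then v j else ord0.
rewrite -(pr_digits q v' mB); congr pr; apply/seteqP; split=> y /= [h1 h2]; split=> //.
  move=> i iq; rewrite /v' insubT/= -h1 ffunE//.
by apply/ffunP => i; rewrite ffunE h1// /v' valK.
Qed.

Lemma digits_indep q (P : pred {ffun 'I_q -> 'I_k.+1}) B : measurable B ->
  pr (@unif R) [set y | P (digits q y) /\ B (iter q E y)] =
    pr (@unif R) [set y | P (digits q y)] * pr (@unif R) B.
Proof.
move=> mB; have mD := @fin_measurable_digits q.
have mP : measurable [set y | P (digits q y)] by have := measurable_pred P mD.
have mPB : measurable [set y | P (digits q y) /\ B (iter q E y)].
  by apply: measurableI => //; exact: measurable_preimage_stretch.
rewrite (pr_partition _ mD mPB) (pr_partition _ mD mP) mulr_suml; apply: eq_bigr => v _.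
have [Pv|nPv] := boolP (P v); last first.
  rewrite [LHS]pr_eq0 => [|y [e [Py _]]]; last by rewrite -e Py in nPv.
  by rewrite [pr _ _]pr_eq0 ?mul0r// => y /= [->]; rewrite (negPf nPv).
have e1 : pr (@unif R) [set y | digits q y = v /\ P (digits q y)] = k.+1%:R^-1 ^+ q.
  have := pr_digitsP v measurableT; rewrite pr_setT mulr1 => <-; congr pr.
  by apply/seteqP; split=> y /= [h _]; split=> //; rewrite h.
rewrite e1 -(pr_digitsP v mB); congr pr.
by apply/seteqP; split=> y /=; [move=> [-> [_ h]]|move=> [-> h]].
Qed.

(** For an invariant B the set C of the y whose concatenation is in B is not
affected by dropping digits.  So it is independent of each event that depends on
finitely many digits, and it is also a limit of such events.  Hence it is
independent of itself. *)
Lemma concat_measure_ergodic : ergodic_measure cms_shift concat_measure.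
Proof.
split; first exact: concat_measure_invariant.
move=> B mB Binv.
have Bit n x : B (iter n cms_shift x) <-> B x.
  elim: n x => // n IH x; apply: (iff_trans _ (IH x)).
  by rewrite -[X in _ <-> X _]Binv.
pose C : set Rm := [set y | B (concat y)].
have mC : measurable C := measurable_concat_iter 0 mB.
have CE n y : C (iter n E y) <-> C y.
  elim: n y => // n IH y; rewrite iterSr IH /C/= -concat_stretch; exact: Bit.
pose b := pr (@unif R) C.
have prB : pr concat_measure B = b.
  rewrite pr_concat_measure// (eq_bigr (fun=> b)).
    by rewrite sumr_const card_ord -(mulr_natl b) mulrA mulVf ?mul1r// pnatr_eq0.
  move=> j _; congr pr; apply/seteqP; split=> y /=; by move=> /Bit.
rewrite (prE concat_measure mB) prB.
suff : b * (1 - b) <= 0.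
  have b0 : 0 <= b by exact: pr_ge0. have b1 : b <= 1 by exact: pr_le1.
  move=> h; have : b * (1 - b) = 0 by apply: le_anti; rewrite h mulr_ge0// subr_ge0.
  by move/eqP; rewrite mulf_eq0 subr_eq0 => /orP[/eqP->|/eqP<-]; [left|right].
apply/ler_addgt0Pl => e e0; rewrite addr0.
have e2 : 0 < e / 2 by lra.
have [m [B' [wB' hB']]] := approximable_measurable (distribution (@unif R) concat) mB e2.
have mB' := window_measurable wB'.
pose C' : set Rm := [set y | B' (concat y)].
have mC' : measurable C' := measurable_concat_iter 0 mB'.
pose P (v : {ffun 'I_m -> 'I_k.+1}) := `[< exists2 y, digits m y = v & C' y >].
have PC y : P (digits m y) <-> C' y.
  split=> [/asboolP[z /ffunP zy]|C'y]; last by apply/asboolP; exists y.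
  apply: wB' => i im; rewrite (concat_eq (n := m) (z := z))// => [j jm|].
    by have := zy (Ordinal jm); rewrite !ffunE.
  by rewrite (leq_trans im)// leq_pmulr.
have := digits_indep P mC.
rewrite (_ : [set y | P (digits m y) /\ C (iter m E y)] = C `&` C'); last first.
  by apply/seteqP; split=> y /=; [move=> [/PC h /CE]|move=> [h /PC h']; split=> //; exact/CE].
rewrite (_ : [set y | P (digits m y)] = C'); last by apply/seteqP; split=> y /PC.
rewrite -/b => h.
have hd : pr (@unif R) ((C `\` C') `|` (C' `\` C)) <= e / 2.
  rewrite -lee_fin -prE; last by apply: measurableU; exact: measurableD.
  exact: ltW.
have h1 : b <= pr (@unif R) (C `&` C') + e / 2.
  apply: (@le_trans _ _ (pr (@unif R) ((C `&` C') `|` ((C `\` C') `|` (C' `\` C))))).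
    apply: le_pr => //.
      by apply: measurableU; [exact: measurableI|apply: measurableU; exact: measurableD].
    by move=> y Cy; have [] := pselect (C' y) => C'y; [left|right; left].
  apply: (le_trans (prU _ _ _)); [exact: measurableI|by apply: measurableU; exact: measurableD|].
  by rewrite lerD2l.
have h2 : pr (@unif R) C' <= b + e / 2.
  apply: (@le_trans _ _ (pr (@unif R) (C `|` ((C `\` C') `|` (C' `\` C))))).
    apply: le_pr => //.
      by apply: measurableU => //; apply: measurableU; exact: measurableD.
    by move=> y C'y; have [] := pselect (C y) => Cy; [left|right; right].
  apply: (le_trans (prU _ _ _)) => //; [by apply: measurableU; exact: measurableD|].
  by rewrite lerD2l.
have b0 : 0 <= b by exact: pr_ge0. have b1 : b <= 1 by exact: pr_le1.
by move: h h1 h2; set c := pr _ C'; set c' := pr _ _; nra.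
Qed.

Lemma law_digit d : law (@unif R) D d = k.+1%:R^-1.
Proof.
have := pr_digit d (@measurableT _ Rm); rewrite pr_setT mulr1 => <-; congr pr.
by apply/seteqP; split=> y /=; [move=> ->|case].
Qed.

Lemma concat_measure_cyl u (x : R) : (forall d, T%:R * x <= (occ u (w d))%:R) ->
  x <= pr concat_measure (cyl u).
Proof.
move=> hx; rewrite pr_concat_measure; last exact: measurable_cyl.
rewrite mulrC ler_pdivlMr ?ltr0n// [x * _]mulrC.
apply: (@le_trans _ _ (\sum_(j < T) \sum_d k.+1%:R^-1 * (prefix u (drop j (w d)))%:R)).
  rewrite exchange_big/=.
  have -> : T%:R * x = \sum_(d : 'I_k.+1) k.+1%:R^-1 * (T%:R * x).
    by rewrite sumr_const card_ord -[RHS]mulr_natl mulrA divff ?mul1r// pnatr_eq0.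
  apply: ler_sum => d _.
  rewrite -mulr_sumr ler_pM2l ?invr_gt0 ?ltr0n// (le_trans (hx d))//.
  by rewrite /occ wT natr_sum.
apply: ler_sum => j _.
have mD := @fin_measurable_digit R k.
have -> : \sum_d k.+1%:R^-1 * (prefix u (drop j (w d)))%:R =
    pr (@unif R) [set y | prefix u (drop j (w (D y)))].
  rewrite (pr_pred (@unif R) (fun d => prefix u (drop j (w d))) mD) [RHS]big_mkcond.
  by apply: eq_bigr => d _; rewrite law_digit; case: prefix; rewrite ?mulr1 ?mulr0.
apply: le_pr.
- by have := measurable_pred (fun d => prefix u (drop j (w d))) mD.
- by apply: measurable_concat_iter; exact: measurable_cyl.
move=> y /prefixP[s hs]; apply/cylP => i lti; rewrite cms_coord_iter concat_coord /concat_seq.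
have ltj : (j + i < T)%N.
  have := congr1 size hs; rewrite size_drop size_cat wT => e.
  by rewrite -ltn_subRL e (leq_trans lti)// leq_addr.
rewrite (divn_small ltj) (modn_small ltj)/= -nth_drop.
by move: hs; rewrite /= => ->; rewrite nth_cat lti.
Qed.

(** The name of length n is a function of the phase and of n / T + 2 digits. *)
Lemma concat_entropy_le M n :
  join_entropy cms_shift concat_measure (alpha M) n <=
    ln T%:R + (n %/ T).+2%:R * ln k.+1%:R.
Proof.
rewrite join_entropyE; set q := (n %/ T).+2.
pose Y x := (Dt x, digits q (Et x)).
have mY : fin_measurable Y.
  apply: fin_measurable_pair; first exact: fin_measurable_digit.
  exact: (fin_measurable_iter (@measurable_stretch R t) 1 (@fin_measurable_digits q)).
apply: (@le_trans _ _ (entropy (law (@unif R) Y))); last first.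
  rewrite (le_trans (entropy_law_le_card _ mY))// card_prod card_ffun !card_ord.
  by rewrite natrM natrX lnM ?posrE ?exprn_gt0 ?ltr0n// lnXn ?ltr0n// mulr_natl.
apply: (@entropy_law_factor _ _ _ (@unif R) _ _ Y (@itinerary _ _ cms_shift _ (alpha M) n \o stationary_map)) => //.
move=> x y [e1 /ffunP e2]; apply/ffunP => i; rewrite !ffunE; apply: val_inj.
rewrite /= !alpha_iter /stationary_map e1 !cms_coord_iter.
rewrite (concat_eq (n := q) (z := Et y))// => [l lq|].
  by have := e2 (Ordinal lq); rewrite !ffunE.
have := ltn_ord (Dt y); have := ltn_ord i; have := ltn_ceil n (ltn0Sn t).
by rewrite /q -/T !mulSn; clear; lia.
Qed.

(** Whatever the phase, a name of length n contains all the loops but the first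
among those of index less than n / T, and so it determines their digits.  Hence
no name has a mass larger than that of a choice of these digits. *)
Lemma concat_entropy_ge M n : injective w -> (forall d, {in w d, forall l, (l <= M)%N}) ->
  ((n %/ T).-1)%:R * ln k.+1%:R <= join_entropy cms_shift concat_measure (alpha M) n.
Proof.
move=> winj wM; set r := (n %/ T).-1.
have mI := fin_measurable_itinerary (@measurable_shift A trA) (n := n) (@fin_measurable_alpha A trA M).
have K0 : 0 < k.+1%:R :> R by rewrite ltr0n.
have -> : r%:R * ln k.+1%:R = - ln (k.+1%:R^-1 ^+ r) :> R.
  by rewrite exprVn lnV ?posrE ?exprn_gt0// opprK lnXn// mulr_natl.
rewrite join_entropyE; apply: entropy_ge; [exact: law_ge0| |exact: law_sum].
move=> v; rewrite [law _ _ _]pr_concat_measure; last exact: mI.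
rewrite mulrC ler_pdivrMr ?ltr0n// mulr_natr -[X in _ *+ X](card_ord T) -sumr_const.
apply: ler_sum => j _; set S := [set y | _].
have [[y0 Sy0]|S0] := pselect (exists y, S y); last first.
  by rewrite pr_eq0 ?exprn_ge0 ?invr_ge0 ?ltW// => y Sy; apply: S0; exists y.
apply: (@le_trans _ _ (pr (@unif R) [set y | digits r (E y) = digits r (E y0)])); last first.
  have mr : measurable [set y | digits r y = digits r (E y0)] by exact: fin_measurable_digits.
  rewrite (pr_stretch k mr); have := pr_digitsP (digits r (E y0)) measurableT.
  rewrite pr_setT mulr1 => <-; apply: le_pr => [//||y /= ->//].
  rewrite (_ : [set y | _] = [set y | digits r y = digits r (E y0)])//.
  by apply/seteqP; split=> y /=; [case|move=> ->].
apply: le_pr.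
- exact: (measurable_concat_iter j (mI v)).
- exact: (fin_measurable_iter (@measurable_stretch R k) 1 (@fin_measurable_digits r)).
move=> y Sy; apply/ffunP => i; rewrite !ffunE; apply: winj.
apply: (@eq_from_nth _ 0%N); rewrite !wT// => l lT.
have h1 : (i.+1 * T + l < n)%N.
  apply: (@leq_trans (i.+2 * T)); first by rewrite [(i.+2 * T)%N]mulSn addnC ltn_add2r.
  rewrite (leq_trans _ (leq_divM n T))// leq_mul2r; apply/orP; right.
  by rewrite -ltn_predRL; exact: ltn_ord i.
have h2 : (j <= i.+1 * T + l)%N.
  rewrite (leq_trans (ltnW (ltn_ord j)))// mulSn -addnA leq_addr//.
have h3 : (i.+1 * T + l - j < n)%N by rewrite (leq_ltn_trans (leq_subr _ _)).
have hv z : S z -> minn (nth 0%N (w (D (iter i E (E z)))) l) M = v (Ordinal h3).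
  rewrite /S/= => <-; rewrite ffunE alpha_iter cms_coord_iter concat_coord /concat_seq/= subnKC//.
  by rewrite divnMDl// divn_small// addn0 modnMDl modn_small// iterSr.
have lM z : (nth 0%N (w (D (iter i E (E z)))) l <= M)%N.
  by apply: (wM (D (iter i E (E z)))); rewrite mem_nth// wT.
by have := hv y Sy; rewrite -(hv y0 Sy0) !(minn_idPl (lM _)).
Qed.

Lemma stationary_map_le M x i : (forall d, {in w d, forall l, (l <= M)%N}) ->
  (cms_coord (stationary_map x) i <= M)%N.
Proof.
move=> wM; rewrite /stationary_map cms_coord_iter concat_coord /concat_seq.
by apply: wM (mem_nth _ _); rewrite wT ltn_mod.
Qed.

End concatenation.

Section compact_support.
Context (A : rel nat) (trA : transitive_matrix A) (R : realType).

Lemma nbhs_ptws_coords n (f : {ptws nat -> nat}) :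
  nbhs f [set g : {ptws nat -> nat} | forall i, (i < n)%N -> g i = f i].
Proof.
elim: n => [|n IH]; first by apply: filterS filterT.
have h : nbhs f [set g : {ptws nat -> nat} | g n = f n].
  exact: (@proj_continuous nat (fun=> nat) n f [set f n] (discrete_set1 _)).
apply: filterS (filterI IH h) => g [/= h1 h2] i; rewrite ltnS leq_eqVlt => /predU1P[->//|].
exact: h1.
Qed.

(** Tychonoff's theorem gives a cluster point among all sequences; it is
admissible because admissibility is a condition on two letters at a time. *)
Lemma compact_bounded_letters M :
  compact [set x : cms trA | forall i, (cms_coord x i <= M)%N].
Proof.
move=> F PF FM.
have cK : compact [set f : {ptws nat -> nat} | forall i, [set m | (m <= M)%N] (f i)].
  apply: (@tychonoff nat (fun=> nat) (fun=> [set m | (m <= M)%N])) => i.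
  apply: finite_compact; rewrite (_ : [set m | _] = `I_M.+1)//.
pose e : cms trA -> {ptws nat -> nat} := set_val.
have PG : ProperFilter (e @ F) by exact: fmap_proper_filter.
have [|f [Kf clf]] := cK (e @ F) PG.
  exact: FM.
have fA : admissible_sequences A f.
  move=> i; have [g [[x _ <-] h]] := clf (range e) _
      (filterS (fun x _ => ex_intro2 _ _ x Logic.I erefl) filterT) (nbhs_ptws_coords i.+2 f).
  by rewrite -!h//; exact: (set_valP x i).
exists (SigSub (mem_set fA)); split=> [i|S V FS].
  exact: Kf.
rewrite nbhsE => -[U [oU Ux] UV].
have [n hn] := open_cyl_base oU Ux.
have [g [[x Sx <-] h]] := clf (e @` S) _
    (filterS (fun x Sx => ex_intro2 _ _ x Sx erefl) FS) (nbhs_ptws_coords n f).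
exists x; split=> //; apply/UV/hn/cylP => i; rewrite size_mkseq => lin.
by rewrite nth_mkseq// -[LHS]/(e x i) h.
Qed.

Lemma measurable_bounded_letters M :
  measurable [set x : cms trA | forall i, (cms_coord x i <= M)%N].
Proof.
rewrite (_ : [set x | _] = \bigcap_i [set x : cms trA | (cms_coord x i <= M)%N]).
  apply: bigcapT_measurable => j; apply: measurable_open; exact: (@open_coord _ trA j (fun m => (m <= M)%N)).
apply/seteqP; split=> y /= h j => [_|]; [exact: h|exact: h j Logic.I].
Qed.

Lemma closed_msupport (mu : probability (cms trA) R) : closed (msupport mu).
Proof.
rewrite -[msupport mu]setCK; apply: open_closedC; rewrite openE => x /existsNP[U /not_implyP[oU /not_implyP[Ux U0]]].
rewrite /interior nbhsE; exists U => // y Uy /(_ U oU Uy); exact: U0.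
Qed.

Lemma compact_msupport (mu : probability (cms trA) R) M :
  mu (~` [set x | forall i, (cms_coord x i <= M)%N]) = 0%E -> compact (msupport mu).
Proof.
move=> h0; apply: (subclosed_compact (@closed_msupport mu) (@compact_bounded_letters M)).
move=> x xs i; rewrite leqNgt; apply/negP => Mx.
pose U : set (cms trA) := [set y | (M < cms_coord y i)%N].
have oU : open U := @open_coord _ trA i (fun m => (M < m)%N).
have := xs U oU Mx; rewrite lt0e => /andP[/eqP + _]; apply.
apply: (subset_measure0 (measurable_open oU) _ _ h0); last first.
  by move=> y /= My h; have := h i; rewrite leqNgt My.
by apply: measurableC; exact: measurable_bounded_letters.
Qed.

End compact_support.

Section limits.
Context (R : realType).

Lemma cvg_bounded_dist (u : nat -> R) (l C : R) : (forall n, `|u n - n%:R * l| <= C) ->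
  u n / n%:R @[n --> \oo] --> l.
Proof.
move=> h; have C0 : 0 <= C by apply: le_trans (h 0%N).
apply/cvgrPdist_le => e e0; exists (Num.truncn (C / e)).+1 => // n /= hn.
have n0 : 0 < n%:R :> R by rewrite ltr0n (leq_ltn_trans _ hn).
have hC : C / e <= n%:R.
  by rewrite (le_trans (ltW (truncnS_gt _)))// ler_nat.
rewrite -(ler_pM2r n0) -[X in _ * X <= _](gtr0_norm n0) -normrM mulrBl divfK ?gt_eqF//.
rewrite distrC [l * _]mulrC (le_trans (h n))// [leRHS]mulrC -ler_pdivrMr//.
Qed.

(** If the limit does not exist then it is 0 by convention, which is why l is
assumed to be nonnegative. *)
Lemma limn_le_affine (u : nat -> R) (l C : R) : 0 <= l -> (forall n, u n <= n%:R * l + C) ->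
  limn (fun n => u n / n%:R) <= l.
Proof.
move=> l0 h; have [cu|/dvgP ->] := pselect (cvgn (fun n => u n / n%:R)); last first.
  by rewrite [point](_ : _ = 0).
have cw : (n%:R * l + C) / n%:R @[n --> \oo] --> l.
  by apply: (@cvg_bounded_dist (fun n => n%:R * l + C) l `|C|) => n; rewrite addrAC subrr add0r.
rewrite -[leRHS](cvg_lim _ cw)//; apply: ler_lim => //; first by apply/cvg_ex; exists l.
by apply: nearW => n; rewrite ler_wpM2r// invr_ge0.
Qed.

End limits.

Section horseshoe_measure.
Context (A : rel nat) (trA : transitive_matrix A) (R : realType).
Variables (k t a : nat) (w : 'I_k.+1 -> seq nat).
Let T := t.+1.
Hypothesis wT : forall d, size (w d) = T.
Hypothesis wp : forall d, path A a (w d).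
Hypothesis wl : forall d, last a (w d) = a.
Let nu := concat_measure trA R wT wp wl.
Let L : R := ln k.+1%:R / T%:R.

Let lnK : 0 <= ln k.+1%:R :> R.
Proof. by rewrite ln_ge0// ler1n. Qed.

Let L0 : 0 <= L. Proof. by rewrite divr_ge0. Qed.

Let lnT : 0 <= ln T%:R :> R.
Proof. by rewrite ln_ge0// ler1n. Qed.

Let concat_entropy_affine M n :
  join_entropy cms_shift nu (alpha M) n <= n%:R * L + (ln T%:R + 2 * ln k.+1%:R).
Proof.
apply: (le_trans (concat_entropy_le trA R wT wp wl M n)).
have : (n %/ t.+1)%:R <= n%:R / T%:R :> R.
  by rewrite ler_pdivlMr ?ltr0n// -natrM ler_nat leq_divM.
move=> /(ler_wpM2r lnK).
have -> : (n %/ t.+1).+2%:R = (n %/ t.+1)%:R + 2 :> R by rewrite -addn2 natrD.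
by rewrite /L; set x := _ / T%:R; rewrite mulrCA -/x; lra.
Qed.

Let concat_entropy_affine_ge M n : injective w -> (forall d, {in w d, forall l, (l <= M)%N}) ->
  n%:R * L - 2 * ln k.+1%:R <= join_entropy cms_shift nu (alpha M) n.
Proof.
move=> winj wM; apply: (le_trans _ (concat_entropy_ge trA R wT wp wl n winj wM)).
have : n%:R / T%:R <= (n %/ t.+1).-1%:R + 2 :> R.
  rewrite ler_pdivrMr ?ltr0n// -natrD -natrM ler_nat.
  have := ltn_ceil n (ltn0Sn t); have : (n %/ t.+1 < (n %/ t.+1).-1 + 2)%N by case: (n %/ t.+1)%N => [|q]//=; rewrite addn2.
  by move=> h /ltnW/leq_trans; apply; rewrite leq_mul2r h orbT.
move=> /(ler_wpM2r lnK); rewrite /L; lra.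
Qed.

Let bounded_letters : exists M, forall d, {in w d, forall l, (l <= M)%N}.
Proof.
exists (\sum_d sumn (w d))%N => d l lw; rewrite (bigD1 d)//= (leq_trans _ (leq_addr _ _))//.
elim: (w d) lw => // x s IH; rewrite in_cons => /predU1P[->|/IH h] /=; first exact: leq_addr.
by rewrite (leq_trans h)// leq_addl.
Qed.

Lemma concat_measure_entropy : injective w -> measure_entropy cms_shift nu = L%:E.
Proof.
move=> winj; have [M wM] := bounded_letters.
apply: le_anti; apply/andP; split.
  apply: ge_ereal_sup => _ [q [Q [mQ ->]]]; rewrite lee_fin; apply/ler_addgt0Pl => e e0.
  have inv : invariant_measure cms_shift nu by exact: concat_measure_invariant.
  have [m hm] := join_entropy_le_alpha inv mQ e0.
  apply: (@limn_le_affine _ _ _ (m%:R * L + (ln T%:R + 2 * ln k.+1%:R))) => [|n].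
    by rewrite addr_ge0// ltW.
  apply: (le_trans (hm n)); have := concat_entropy_affine m (n + m).
  by rewrite natrD; lra.
apply: ereal_sup_ubound; exists M.+1, (alpha M); split; first exact: fin_measurable_alpha.
congr EFin; apply/esym/cvg_lim => //.
apply: (@cvg_bounded_dist _ _ _ (ln T%:R + 2 * ln k.+1%:R)) => n.
have := concat_entropy_affine M n; have := concat_entropy_affine_ge n winj wM.
move: (ln _) lnT lnK => lT; move: (ln k.+1%:R) => lK lT0 lK0 h1 h2.
by rewrite ler_norml; apply/andP; split; lra.
Qed.

Lemma concat_measure_compact : compact (msupport nu).
Proof.
have [M wM] := bounded_letters.
apply: (@compact_msupport _ _ _ _ M).
have mB : measurable (~` [set x : cms trA | forall i, (cms_coord x i <= M)%N]).
  by apply: measurableC; exact: measurable_bounded_letters.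
rewrite (prE nu mB) pr_concat_measureE pr_eq0// => x h; apply: h => i.
exact: stationary_map_le.
Qed.

End horseshoe_measure.

(** * Weak* convergence from lower bounds on cylinders *)

Section staircase.
Context (R : realType).

(** The multiple of dl obtained by rounding y down, except that a positive
multiple of dl goes to the preceding one and that values stop at r * dl.  It
reduces integrals to masses of open sets. *)
Definition stair (dl : R) r (y : R) := \sum_(i < r) dl * (i.+1%:R * dl < y)%R%:R.

Lemma stair_le dl r y : 0 <= dl -> 0 <= y -> stair dl r y <= y.
Proof.
move=> dl0 y0; elim: r => [|r IH]; first by rewrite /stair big_ord0.
rewrite /stair big_ord_recr/= -/(stair dl r y).
have [h|h] := ltP; last by rewrite mulr0 addr0.
rewrite mulr1 (le_trans _ (ltW h))// -[in leRHS]natr1 mulrDl mul1r lerD2r.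
apply: (@le_trans _ _ (\sum_(i < r) dl)).
  by apply: ler_sum => i _; case: (_ < y); rewrite ?mulr1 ?mulr0.
by rewrite sumr_const card_ord mulr_natl.
Qed.

Lemma le_stair dl r y : 0 <= dl -> y <= r.+1%:R * dl -> y <= dl + stair dl r y.
Proof.
move=> dl0; elim: r => [|r IH] hy; first by rewrite /stair big_ord0 addr0; rewrite mul1r in hy.
rewrite /stair big_ord_recr/= -/(stair dl r y).
have [h|h] := ltP (r.+1%:R * dl) y; last by rewrite mulr0 addr0 IH.
rewrite mulr1 (_ : stair dl r y = r%:R * dl).
  by move: hy; rewrite -!natr1; lra.
rewrite /stair (eq_bigr (fun=> dl)); first by rewrite sumr_const card_ord mulr_natl.
move=> i _; rewrite (_ : _ < _) ?mulr1//; apply: le_lt_trans h.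
by rewrite ler_wpM2r// ler_nat ltnS ltnW.
Qed.

End staircase.

Section integrals.
Context d (T : measurableType d) (R : realType) (nu : probability T R).

Lemma integrable_bounded (f : T -> R) M : measurable_fun setT f -> (forall x, `|f x| <= M) ->
  nu.-integrable setT (EFin \o f).
Proof.
move=> mf fM; apply: measurable_bounded_integrable => //.
  by rewrite (le_lt_trans (probability_le1 _ _))// ltry.
exists M; split; first exact: num_real.
by move=> y My x _; exact: le_trans (fM x) (ltW My).
Qed.

Lemma integral_stair (g : T -> R) dl r : measurable_fun setT g -> 0 <= dl ->
  (\int[nu]_x (stair dl r (g x))%:E = (\sum_(i < r) dl * pr nu [set x | (i.+1%:R * dl < g x)%R])%:E)%E.
Proof.
move=> mg dl0; pose U (i : nat) := [set x | i.+1%:R * dl < g x].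
have mU i : measurable (U i).
  by have := mg measurableT _ (measurable_itv `]i.+1%:R * dl, +oo[); rewrite setTI; congr measurable;
    apply/seteqP; split=> x /=; rewrite in_itv/= andbT.
transitivity (\int[nu]_x \sum_(i < r) (dl%:E * (\1_(U i) x)%:E))%E.
  apply: eq_integral => x _; rewrite /stair -sumEFin; apply: eq_bigr => i _.
  rewrite -EFinM indicE; congr (_ * _)%:E; congr (_ %:R); congr nat_of_bool.
  by apply/idP/idP; rewrite inE.
have mI i : measurable_fun setT (fun x => (\1_(U i) x)%:E : \bar R).
  by apply/measurable_EFinP; exact: measurable_indic.
rewrite ge0_integral_sum//; last 2 first.
- by move=> i; exact: measurable_funeM.
- by move=> i x _; rewrite mule_ge0// lee_fin.
rewrite -sumEFin; apply: eq_bigr => i _.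
rewrite ge0_integralZl_EFin//.
by rewrite integral_indic// setIT EFinM; congr (_ * _)%E; exact: (prE nu (mU i)).
Qed.

Lemma integral_between (g : T -> R) dl r : measurable_fun setT g -> 0 <= dl ->
  (forall x, 0 <= g x <= r.+1%:R * dl) ->
  \sum_(i < r) dl * pr nu [set x | i.+1%:R * dl < g x] <= fine (\int[nu]_x (g x)%:E)
    <= dl + \sum_(i < r) dl * pr nu [set x | i.+1%:R * dl < g x].
Proof.
move=> mg dl0 hg; set S := \sum_(i < r) _.
have g0 x : 0 <= g x by have /andP[] := hg x.
have ig : (\int[nu]_x (g x)%:E \is a fin_num)%E.
  apply: integrable_fin_num => //; apply: (@integrable_bounded _ (r.+1%:R * dl)) => // x.
  by rewrite ger0_norm//; have /andP[] := hg x.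
have mgE : measurable_fun setT (fun x => (g x)%:E) by exact/measurable_EFinP.
have ms : measurable_fun setT (fun x => stair dl r (g x)).
  apply: measurable_sum => i; apply: measurable_funM => //.
  apply: measurableT_comp => //. apply: measurable_fun_ltr => //.
have msE : measurable_fun setT (fun x => (stair dl r (g x))%:E) by exact/measurable_EFinP.
have s0 x : 0 <= stair dl r (g x) by apply: sumr_ge0 => i _; exact: mulr_ge0.
rewrite -!lee_fin fineK// EFinD -(integral_stair r mg dl0); apply/andP; split.
  by apply: ge0_le_integral => // x _; rewrite lee_fin ?stair_le.
rewrite -[X in (X + _)%E]mule1 -(probability_setT nu) -(integral_cst nu measurableT dl%:E).
rewrite -ge0_integralD//; last by move=> x _; rewrite lee_fin.
apply: ge0_le_integral => //.
- by move=> x _; rewrite lee_fin.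
- exact: emeasurable_funD.
- by move=> x _; rewrite lee_fin le_stair//; have /andP[] := hg x.
Qed.

End integrals.

Section weak_star.
Context (A : rel nat) (trA : transitive_matrix A) (R : realType).
Context (mu_ : nat -> probability (cms trA) R) (mu : probability (cms trA) R).

Hypothesis cyl_liminf : forall u (e : R), 0 < e ->
  \forall n \near \oo, pr mu (cyl u) <= pr (mu_ n) (cyl u) + e.

Let letters k M (w : k.-tuple 'I_M) : seq nat := map val w.

Let size_letters k M (w : k.-tuple 'I_M) : size (letters w) = k.
Proof. by rewrite size_map size_tuple. Qed.

Let letters_inj k M : injective (@letters k M).
Proof. by move=> w w' /(inj_map val_inj)/val_inj. Qed.

(** Up to a set of small measure for mu, the open set U is a finite disjoint union
of cylinders of one length. *)
Lemma open_liminf (U : set (cms trA)) (e : R) : open U -> 0 < e ->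
  \forall n \near \oo, pr mu U <= pr (mu_ n) U + e.
Proof.
move=> oU e0; have e3 : 0 < e / 3 by lra.
have mU := measurable_open oU.
pose F k : set (cms trA) := U `&` ~` [set x | cyl (pfx x k) `<=` U].
have oC k : open [set x : cms trA | cyl (pfx x k) `<=` U].
  rewrite openE => x /= hx; rewrite /interior nbhsE; exists (cyl (pfx x k)).
    by split; [exact: open_cyl|rewrite /cyl/= size_mkseq].
  by move=> y; rewrite /cyl/= size_mkseq => ->.
have [k hk] : exists k, pr mu (F k) <= e / 3.
  apply: pr_decreasing => // [n|m n mn x [Ux h]|x].
  - by apply: measurableI => //; apply: measurableC; apply: measurable_open.
  - split=> // h'; apply: h => y /cylP; rewrite size_mkseq => hy; apply: h'.
    apply/cylP; rewrite size_mkseq => i im.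
    by have := hy i (leq_trans im mn); rewrite !nth_mkseq// (leq_trans im mn).
  - have [Ux|nUx] := pselect (U x); last by exists 0%N => -[].
    by have [n hn] := open_cyl_base oU Ux; exists n => -[_]; apply.
have [M hM] := letters_bounded mu k e3.
pose B := ~` [set x : cms trA | forall i, (i < k)%N -> (cms_coord x i < M)%N].
have mB : measurable B.
  by apply: measurableC; exact: (@measurable_coords _ trA k (fun _ z => (z < M)%N)).
have mF : measurable (F k).
  by apply: measurableI => //; apply: measurableC; exact: measurable_open.
pose V_ := @read _ trA _ k (@letters k M).
have V_P x w : V_ x = Some w <-> cyl (letters w) x := readP (@size_letters k M) (@letters_inj k M) x w.
have mV_ : fin_measurable V_ := fin_measurable_read (@size_letters k M) (@letters_inj k M).
pose Q (w : k.-tuple 'I_M) := `[< @cyl _ trA (letters w) `<=` U >].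
pose P o := if o is Some w then Q w else false.
pose V : set (cms trA) := [set x | P (V_ x)].
have mV : measurable V by have := measurable_pred P mV_.
have VU : V `<=` U.
  by move=> x; rewrite /V/= /P; case ew: (V_ x) => [w|//] /asboolP; apply; exact/V_P.
have prV (nu : probability (cms trA) R) : pr nu V = \sum_(w | Q w) pr nu (cyl (letters w)).
  rewrite /V (pr_pred nu P mV_) big_mkcond big_option/= add0r.
  rewrite [RHS]big_mkcond; apply: eq_bigr => w _; case: ifP => // _.
  exact: (law_read (@size_letters k M) (@letters_inj k M)).
have h1 : pr mu U <= pr mu V + e / 3 + e / 3.
  apply: (@le_trans _ _ (pr mu (V `|` F k `|` B))).
    apply: le_pr => //; first by apply: measurableU => //; exact: measurableU.
    move=> x Ux; have [Bx|/contrapT xM] := pselect (B x); first by right.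
    left; have [hx|nhx] := pselect (cyl (pfx x k) `<=` U); last by right.
    left; pose w : k.-tuple 'I_M := [tuple Ordinal (xM i (ltn_ord i)) | i < k].
    have e1 : letters w = pfx x k.
      apply: (@eq_from_nth _ 0%N); first by rewrite size_map size_tuple size_mkseq.
      rewrite size_map size_tuple => i ik; rewrite nth_mkseq// (nth_map (Ordinal (xM _ ik))) ?size_tuple//.
      by rewrite -(tnth_nth _ _ (Ordinal ik)) tnth_mktuple.
    have : V_ x = Some w.
      by apply/V_P; rewrite e1 /cyl/= size_mkseq.
    by rewrite /V/= => ->; apply/asboolP; rewrite e1.
  apply: (le_trans (prU _ _ _)) => //; first exact: measurableU.
  by rewrite lerD// (le_trans (prU _ _ _))// lerD2l.
pose N := #|{: k.-tuple 'I_M}|.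
pose e' := e / 3 / N.+1%:R.
have e'0 : 0 < e' by rewrite divr_gt0.
have : \forall n \near \oo, forall w : k.-tuple 'I_M,
    pr mu (cyl (letters w)) <= pr (mu_ n) (cyl (letters w)) + e'.
  by apply: filter_forall => w; exact: cyl_liminf.
apply: filterS => n hn.
have h2 : pr mu V <= pr (mu_ n) V + e / 3.
  rewrite !prV; apply: (@le_trans _ _ (\sum_(w | Q w) (pr (mu_ n) (cyl (letters w)) + e'))).
    by apply: ler_sum => w _.
  rewrite big_split/= lerD2l sumr_const -[leLHS]mulr_natr -/N.
  apply: (@le_trans _ _ (e' * N.+1%:R)); last by rewrite /e' divfK// pnatr_eq0.
  by rewrite ler_pM2l// ler_nat (leq_trans (max_card _))//.
have h3 : pr (mu_ n) V <= pr (mu_ n) U by exact: le_pr.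
by lra.
Qed.

Lemma integral_liminf (g : cms trA -> R) (C e : R) : continuous g ->
  (forall x, 0 <= g x <= C) -> 0 < e ->
  \forall n \near \oo,
    fine (\int[mu]_x (g x)%:E) <= fine (\int[mu_ n]_x (g x)%:E) + e.
Proof.
move=> cg gC e0; pose dl := e / 2; have dl0 : 0 < dl by rewrite /dl; lra.
have mg := cms_continuous_measurable cg.
pose r := Num.truncn (C / dl).
have hr x : 0 <= g x <= r.+1%:R * dl.
  have /andP[-> h] := gC x; rewrite (le_trans h)//= -ler_pdivrMr// ltW//.
  exact: truncnS_gt.
pose e' := dl / (r%:R * dl + 1).
have den0 : 0 < r%:R * dl + 1 by rewrite ltr_wpDl// mulr_ge0// ltW.
have e'0 : 0 < e' by rewrite divr_gt0.
have oU (i : nat) : open [set x | i.+1%:R * dl < g x].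
  have := @open_comp _ _ g `]i.+1%:R * dl, +oo[%classic; rewrite (_ : _ @^-1` _ = [set x | i.+1%:R * dl < g x]).
    by apply => //; exact: rray_open.
  by apply/seteqP; split=> x /=; rewrite in_itv/= andbT.
have : \forall n \near \oo, forall i : 'I_r,
    pr mu [set x | i.+1%:R * dl < g x] <= pr (mu_ n) [set x | i.+1%:R * dl < g x] + e'.
  by apply: filter_forall => i; exact: open_liminf.
apply: filterS => n hn.
have /andP[_ h1] := integral_between mu mg (ltW dl0) hr.
have /andP[h2 _] := integral_between (mu_ n) mg (ltW dl0) hr.
apply: (le_trans h1).
have h3 : \sum_(i < r) dl * pr mu [set x | i.+1%:R * dl < g x] <=
    \sum_(i < r) dl * pr (mu_ n) [set x | i.+1%:R * dl < g x] + dl.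
  apply: (@le_trans _ _ (\sum_(i < r) (dl * pr (mu_ n) [set x | i.+1%:R * dl < g x] + dl * e'))).
    by apply: ler_sum => i _; rewrite -mulrDr ler_pM2l.
  rewrite big_split/= lerD2l sumr_const card_ord -[leLHS]mulr_natl mulrA.
  apply: (@le_trans _ _ ((r%:R * dl + 1) * e')); first by rewrite ler_pM2r// lerDl.
  by rewrite mulrC /e' divfK// gt_eqF.
have : e = dl + dl by rewrite /dl; lra.
by lra.
Qed.

(** The bounds from below for M + f and for M - f are bounds from both sides for
f. *)
Lemma weak_star_cvg_cyl : weak_star_cvg mu_ mu.
Proof.
move=> f cf [M fM].
have mf := cms_continuous_measurable cf.
have If (nu : probability (cms trA) R) : nu.-integrable setT (EFin \o f) := integrable_bounded nu mf fM.
have finf (nu : probability (cms trA) R) : (\int[nu]_x (f x)%:E)%E \is a fin_num.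
  by apply: integrable_fin_num => //; exact: If.
have IM (nu : probability (cms trA) R) : (\int[nu]_x (cst M x)%:E = M%:E)%E.
  have := integral_cst nu measurableT M%:E; rewrite [X in (_ * X)%E](probability_setT nu) mule1.
  exact.
have intM (nu : probability (cms trA) R) : nu.-integrable setT (EFin \o cst M).
  apply: (@integrable_bounded _ _ _ _ _ `|M|) => //.
have ID (nu : probability (cms trA) R) :
    fine (\int[nu]_x (M + f x)%:E) = M + fine (\int[nu]_x (f x)%:E).
  have -> : (\int[nu]_x (M + f x)%:E = \int[nu]_x ((cst M x)%:E + (f x)%:E))%E by [].
  rewrite (integralD_EFin measurableT (intM nu) (If nu)) IM.
  by rewrite fineD//; exact: finf.
have IB (nu : probability (cms trA) R) :
    fine (\int[nu]_x (M - f x)%:E) = M - fine (\int[nu]_x (f x)%:E).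
  have -> : (\int[nu]_x (M - f x)%:E = \int[nu]_x ((cst M x)%:E - (f x)%:E))%E by [].
  rewrite (integralB_EFin measurableT (intM nu) (If nu)) IM.
  by rewrite fineB//; exact: finf.
rewrite -[X in _ --> X]fineK//; apply: cvg_EFin; first by apply: nearW => n; exact: finf.
apply/cvgrPdist_le => e e0.
have cD : continuous (fun x => M + f x).
  by move=> x; apply: continuousD; [exact: cst_continuous|exact: cf].
have cB : continuous (fun x => M - f x).
  by move=> x; apply: continuousB; [exact: cst_continuous|exact: cf].
have b1 x : 0 <= M + f x <= 2 * M.
  by have := fM x; rewrite ler_norml => /andP[h1 h2]; apply/andP; split; lra.
have b2 x : 0 <= M - f x <= 2 * M.
  by have := fM x; rewrite ler_norml => /andP[h1 h2]; apply/andP; split; lra.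
apply: filterS2 (integral_liminf cD b1 e0) (integral_liminf cB b2 e0).
move=> n h1 h2; rewrite !ID in h1; rewrite !IB in h2.
by rewrite ler_norml /=; apply/andP; split; lra.
Qed.

End weak_star.

(** * Entropy density *)

Section density.
Context (A : rel nat) (trA : transitive_matrix A) (R : realType).
Context (mu : probability (cms trA) R).
Hypothesis inv : invariant_measure cms_shift mu.

Lemma measure_entropy_ge0 : (0 <= measure_entropy cms_shift mu)%E.
Proof.
apply: ereal_sup_ubound; exists 1%N, (fun _ : cms trA => ord0).
have mP : fin_measurable (fun _ : cms trA => ord0 : 'I_1).
  by apply: (@fin_measurable_window _ _ 0).
split=> //; rewrite /partition_entropy (_ : (fun n => _) = cst 0) ?lim_cst//.
apply/funext => n /=; rewrite (_ : join_entropy _ _ _ _ = 0) ?mul0r//.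
apply: le_anti; rewrite join_entropy_ge0// andbT join_entropyE.
apply: (le_trans (entropy_law_le_card _ _)).
  by apply: fin_measurable_itinerary => //; exact: measurable_shift.
by rewrite card_ffun !card_ord exp1n ln1.
Qed.

(** Keep only min (#|D|, floor (exp (T c))) of the loops of a horseshoe D.  If T is
large then rounding and the loss in the horseshoe change the entropy by at most
e. *)
Lemma ergodic_approximation (c e : R) (n : nat) : 0 <= c ->
  (c%:E <= measure_entropy cms_shift mu)%E -> 0 < e ->
  exists nu : probability (cms trA) R,
    [/\ ergodic_measure cms_shift nu, compact (msupport nu),
        forall u, (size u <= n)%N -> pr mu (cyl u) <= pr nu (cyl u) + e &
        exists2 r, measure_entropy cms_shift nu = r%:E & `|r - c| <= e].
Proof.
move=> c0 ch e0; have e8 : 0 < e / 8 by lra.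
have [a [T [D [hT uD [D0 hD] Dw Docc]]]] := horseshoe inv n (Num.truncn e^-1).+1 ch e8.
have Te : 1 <= T%:R * e.
  rewrite -ler_pdivrMr// mul1r (le_trans (ltW (truncnS_gt _)))// ler_nat.
  exact: hT.
case: T hT hD Dw Docc Te => // t _ hD Dw Docc Te.
have T0 : 0 < t.+1%:R :> R by rewrite ltr0n.
pose x : R := expR (t.+1%:R * c).
have x1 : 1 <= x by rewrite /x -expR0 ler_expR mulr_ge0.
have x0 : 0 < x by exact: lt_le_trans x1.
have tx1 : (0 < Num.truncn x)%N by rewrite truncn_gt0.
have /andP[tx tx'] := truncn_itv (ltW x0).
have [k hk] : exists k, minn (size D) (Num.truncn x) = k.+1.
  by exists (minn (size D) (Num.truncn x)).-1; rewrite prednK// leq_min D0.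
have kD : (k.+1 <= size D)%N by rewrite -hk geq_minl.
pose w (d : 'I_k.+1) := nth [::] D d.
have wD d : w d \in D by rewrite mem_nth// (leq_trans (ltn_ord d)).
have wT d : size (w d) = t.+1 by have [] := Dw _ (wD d).
have wp d : path A a (w d) by have [] := Dw _ (wD d).
have wl d : last a (w d) = a by have [] := Dw _ (wD d).
have winj : injective w.
  move=> d d' /eqP; rewrite /w nth_uniq// ?(leq_trans (ltn_ord _))//.
  by move=> /eqP/val_inj.
exists (concat_measure trA R wT wp wl); split.
- exact: concat_measure_ergodic.
- exact: concat_measure_compact.
- move=> u un; rewrite -lerBlDr; apply: concat_measure_cyl => d.
  by apply: le_trans (Docc _ _ (wD d) un); rewrite ler_pM2l//; lra.
- exists (ln k.+1%:R / t.+1%:R); first exact: concat_measure_entropy.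
  have k0 : 0 < k.+1%:R :> R by rewrite ltr0n.
  have up : ln k.+1%:R <= t.+1%:R * c.
    rewrite -[leRHS](expRK) ler_ln ?posrE ?expR_gt0//.
    by apply: le_trans tx; rewrite ler_nat -hk geq_minr.
  have lo : t.+1%:R * (c - e) <= ln k.+1%:R.
    have [h|h] := leqP (size D) (Num.truncn x).
      move: hk; rewrite (minn_idPl h) => <-; apply: le_trans hD.
      by rewrite ler_pM2l//; lra.
    move: hk; rewrite (minn_idPr (ltnW h)) => hk.
    have h2 : x <= 2 * k.+1%:R.
      by rewrite (le_trans (ltW tx'))// hk -natrM ler_nat mul2n -addnn addSnnS leq_addl.
    have : ln x <= ln (2 * k.+1%:R) by rewrite ler_ln ?posrE ?mulr_gt0.
    have ln2 : ln 2 <= 1 :> R by have := @ln_le_sub1 R 2 (ltr0Sn _ _); lra.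
    rewrite expRK lnM ?posrE//; lra.
  rewrite -(ler_pM2r T0) -[X in _ * X <= _](gtr0_norm T0) -normrM mulrBl divfK ?gt_eqF//.
  by rewrite ler_norml; apply/andP; split; lra.
Qed.

Lemma compact_ergodic_sequence : exists mu_ : nat -> probability (cms trA) R,
  [/\ forall n, ergodic_measure cms_shift (mu_ n),
      forall n, compact (msupport (mu_ n)),
      weak_star_cvg mu_ mu &
      measure_entropy cms_shift (mu_ n) @[n --> \oo] -->
        measure_entropy cms_shift mu].
Proof.
have h0 := measure_entropy_ge0; set h := measure_entropy cms_shift mu in h0 *.
have [c [c0 ch ccv]] : exists c : nat -> R,
    [/\ forall n, 0 <= c n, forall n, ((c n)%:E <= h)%E & (c n)%:E @[n --> \oo] --> h].
  case: h h0 => [r|//|//] r0; first by exists (fun=> r); split=> // n; exact: cvg_cst.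
  exists (fun n => n%:R); split=> [n|n|]; [exact: ler0n|exact: leey|].
  exact/cvgeryP/cvgr_idn.
have e0 n : 0 < n.+1%:R^-1 :> R by rewrite invr_gt0 ltr0n.
have /choice[mu_ hmu] n := ergodic_approximation n (c0 n) (ch n) (e0 n).
exists mu_; split=> [n|n||]; [by have [] := hmu n|by have [] := hmu n| |].
  apply: weak_star_cvg_cyl => u e ep; exists (size u + Num.truncn e^-1)%N => // n /= hn.
  have [_ _ /(_ u) h1 _] := hmu n.
  apply: (le_trans (h1 (leq_trans (leq_addr _ _) hn))); rewrite lerD2l.
  rewrite invf_ple ?posrE// (le_trans (ltW (truncnS_gt _)))// ler_nat ltnS.
  exact: leq_trans (leq_addl _ _) hn.
have /choice[r hr] n : exists r, measure_entropy cms_shift (mu_ n) = r%:E /\ `|r - c n| <= n.+1%:R^-1.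
  by have [_ _ _ [r h1 h2]] := hmu n; exists r.
rewrite (_ : (fun n => _) = (fun n => (r n)%:E)); last first.
  by apply/funext => n; rewrite (hr n).1.
rewrite (_ : (fun n => _) = (fun n => (c n)%:E + (r n - c n)%:E)%E); last first.
  by apply/funext => n; rewrite -EFinD subrKC.
rewrite -[h]adde0; apply: cvgeD; [exact: fin_num_adde_defl|exact: ccv|].
apply/fine_cvgP; split; first exact: nearW.
apply/cvgrPdist_le => e ep; exists (Num.truncn e^-1) => // n /= hn.
rewrite sub0r normrN (le_trans (hr n).2)// invf_ple ?posrE//.
by rewrite (le_trans (ltW (truncnS_gt _)))// ler_nat ltnS.
Qed.

End density.

Theorem theorem8p7 (R : realType) (A : rel nat) (trA : transitive_matrix A)
    (finA : finite_entropy trA R) :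
  entropy_dense [set nu : probability (cms trA) R | ergodic_measure cms_shift nu] /\
  forall mu : probability (cms trA) R, invariant_measure cms_shift mu ->
    exists mu_ : nat -> probability (cms trA) R,
      [/\ forall n, ergodic_measure cms_shift (mu_ n),
          forall n, compact (msupport (mu_ n)),
          weak_star_cvg mu_ mu &
          measure_entropy cms_shift (mu_ n) @[n --> \oo] -->
            measure_entropy cms_shift mu].
Proof.
split=> mu /compact_ergodic_sequence //.
by move=> [mu_ [erg _ weak ent]]; exists mu_.
Qed.
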